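(* Let $L\subset\mathbb{Z}^n$ be a lattice. The ideal $I_L$ is a binomial complete intersection if and only if either $L^\sigma=\{\mathbf{0}\}$ or there exists a basis of $L^\sigma$ whose vectors give the rows of a mixed dominating matrix.
   Context: Let $\Bbbk$ be a field, $\mathbb{N}=\mathbb{Z}_{\ge0}$. A lattice is a subgroup $L\subset\mathbb{Z}^n$; its lattice ideal is $I_L=\langle x^u-x^v:u,v\in\mathbb{N}^n,\ u-v\in L\rangle\subset\Bbbk[x_1,\ldots,x_n]$. Let $\sigma=\bigcup_{w\in L\cap\mathbb{N}^n}\operatorname{supp}(w)\subset\{1,\dots,n\}$, where $\operatorname{supp}(w)=\{i:w_i\ne0\}$. For $u\in\mathbb{Z}^n$, $u^\sigma=(u_i)_{i\notin\sigma}$ (with $u^\sigma=0$ if $\sigma=\{1,\dots,n\}$). $L^\sigma$ is the lattice generated by the vectors $u^\sigma$, $u\in L$. A lattice ideal of height $r$ is a binomial complete intersection if it can be generated by $r$ binomials, where a binomial means a difference $x^u-x^v$ of two distinct monomials. A matrix $M$ is mixed dominating if every row of $M$ has a positive and a negative entry and $M$ contains no square submatrix with this property. *)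

(* Defs.v *)
From HB Require Import structures.
From mathcomp Require Import all_boot all_order all_algebra.
From mathcomp Require Import boolp mpoly.

Set Implicit Arguments.
Unset Strict Implicit.
Unset Printing Implicit Defensive.

Import Order.TTheory GRing.Theory Num.Theory.
Local Open Scope ring_scope.

(* Subsets (lattices, ideals) are boolean predicates; through `[< _ >] from
   boolp, every Prop-valued predicate is one, so they are arbitrary subsets. *)

Section Ideals.
Variable R : comNzRingType.
Implicit Types (I P : {pred R}) (S : R -> Prop) (h k : nat).

Definition ideal_gen S : {pred R} :=
  [pred p | `[< exists m (c q : 'I_m -> R),
                  (forall i, S (q i)) /\ p = \sum_i c i * q i >]].

(* idealr_closed already excludes the unit ideal. *)
Definition prime_ideal P := idealr_closed P /\ prime_idealr_closed P.

(* C 0 < C 1 < ... < C k; the values of C beyond k are irrelevant. *)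
Definition prime_chain k (C : nat -> {pred R}) :=
  (forall i, (i <= k)%N -> prime_ideal (C i)) /\
  (forall i, (i < k)%N ->
     {subset C i <= C i.+1} /\ ~ {subset C i.+1 <= C i}).

(* The lengths of the prime chains ending at P are exactly 0, ..., h. *)
Definition prime_height P h :=
  forall k, (exists2 C, prime_chain k C & C k =i P) <-> (k <= h)%N.

(* The minimum of the heights of the primes containing I; primes of infinite
   height satisfy prime_height for no h and do not affect a finite minimum. *)
Definition ideal_height I r :=
  (exists P, [/\ prime_ideal P, {subset I <= P} & prime_height P r]) /\
  (forall P h, prime_ideal P -> {subset I <= P} -> prime_height P h ->
     (r <= h)%N).

End Ideals.

Section LatticeIdeals.
Variables (K : fieldType) (n : nat).
Implicit Types (L : {pred 'rV[int]_n}) (p : {mpoly K[n]}).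

Definition is_binomial p :=
  exists u v : 'X_{1..n}, u != v /\ p = 'X_[u] - 'X_[v].

Definition mnm_diff (u v : 'X_{1..n}) : 'rV[int]_n :=
  \row_i ((u i)%:Z - (v i)%:Z).

Definition lattice_ideal L : {pred {mpoly K[n]}} :=
  ideal_gen (fun p => exists u v : 'X_{1..n},
                        mnm_diff u v \in L /\ p = 'X_[u] - 'X_[v]).

Definition binomial_complete_intersection (I : {pred {mpoly K[n]}}) :=
  exists r, ideal_height I r /\
    exists b : 'I_r -> {mpoly K[n]},
      (forall i, is_binomial (b i)) /\
      I =i ideal_gen (fun p => exists i, p = b i).

End LatticeIdeals.

Arguments lattice_ideal K {n} L.

Section Lattices.
Variable n : nat.
Implicit Types (L : {pred 'rV[int]_n}) (u w : 'rV[int]_n).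

Definition lattice_gen (S : 'rV[int]_n -> Prop) : {pred 'rV[int]_n} :=
  [pred w | `[< exists m (c : 'I_m -> int) (q : 'I_m -> 'rV[int]_n),
                  (forall i, S (q i)) /\ w = \sum_i c i *: q i >]].

(* The rows of M form a Z-basis of L. *)
Definition lattice_basis m (M : 'M[int]_(m, n)) L :=
  (forall w, w \in L <-> exists c : 'rV[int]_m, w = c *m M) /\
  (forall c : 'rV[int]_m, c *m M = 0 -> c = 0).

Definition supp w : {set 'I_n} := [set i | w 0 i != 0].

Definition sigma L : {set 'I_n} :=
  [set i | `[< exists w, [/\ w \in L, forall j, 0 <= w 0 j & i \in supp w] >]].

(* u^s = (u_i)_{i notin s}; the remaining coordinates are renumbered in
   increasing order. *)
Definition drop_coords (s : {set 'I_n}) u : 'rV[int]_#|~: s| :=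
  colsub (fun j : 'I_#|~: s| => enum_val j) u.

End Lattices.

Definition sigma_lattice n (L : {pred 'rV[int]_n}) :
    {pred 'rV[int]_#|~: sigma L|} :=
  lattice_gen (fun w => exists2 u, u \in L & w = drop_coords (sigma L) u).

Arguments sigma_lattice {n} L.

Definition mixed m p (M : 'M[int]_(m, p)) :=
  forall i, (exists j, 0 < M i j) /\ (exists j, M i j < 0).

(* The 0 x 0 submatrix, which is vacuously mixed, does not count. *)
Definition mixed_dominating m p (M : 'M[int]_(m, p)) :=
  mixed M /\
  forall (I : {set 'I_m}) (J : {set 'I_p}),
    #|I| = #|J| -> (0 < #|I|)%N ->
    ~ mixed (mxsub (fun i : 'I_#|I| => enum_val i)
                   (fun j : 'I_#|J| => enum_val j) M).

(* Main.v *)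
Require Import Defs.
From HB Require Import structures.
From mathcomp Require Import all_boot all_order all_algebra.
From mathcomp Require Import boolp mpoly.
From mathcomp Require classical_sets.
From mathcomp Require Import zify.

Set Implicit Arguments.
Unset Strict Implicit.
Unset Printing Implicit Defensive.

Import Order.TTheory GRing.Theory Num.Theory.
Local Open Scope ring_scope.

(** Two independent facts are combined.

    The height of the lattice ideal is the rank [r] of [L]
    ([lattice_ideal_height]).  For the lower bound, the binomials of a basis of
    [L] are successively regular: multiplying by [x^a - x^b] is injective modulo the
    ideal of a lattice for which [a - b] has infinite order ([binomial_regular]).
    Hence below every prime containing the ideal one can go down [r] times, by
    Krull's lemma on primes avoiding a multiplicative set ([prime_avoiding],
    [lattice_prime_chain]).  For the upper bound, there are [n - r] variables
    whose monomials are pairwise incongruent modulo [L], and a prime over the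
    ideal that contains no nonzero polynomial in them.  A chain of [k] steps
    below this prime produces [k] further algebraically independent elements,
    and comparing the number of their monomials with the dimension of the space
    of polynomials of bounded degree gives [k + (n - r) <= n]
    ([prime_chain_bound]).

    Whether given binomials [x^a - x^b] generate the ideal is a question about the
    congruence [u - v \in L] on nonnegative vectors: it must be generated by the
    moves [a <-> b] ([lattice_ideal_generated]).  So the theorem says that
    [rank L] moves can connect all congruent points if and only if the projection
    of [L] off [sigma] has a mixed dominating basis.

    If such a basis is given, suppose that two points differ by a combination
    [c] of its rows and that no row with nonzero coefficient can be applied at the
    first point.  Each row is then blocked at some column, which must carry the
    opposite sign in another row; following these rows around a cycle exhibits a
    square mixed submatrix ([legal_move]).  So one can always approach the second
    point.  The coordinates in [sigma] never block a move for good, because the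
    part of [L] inside [sigma] has a basis of nonnegative vectors
    ([nonneg_basis]), which can be added at any point.

    If conversely [rank L] moves connect, their differences form a basis of [L].
    The moves that take place inside [sigma] generate the part of [L] inside
    [sigma], so the other differences project to a basis of the projected
    lattice.  Its rows are mixed because this lattice has no nonzero nonnegative
    vector.  The columns of a square mixed submatrix could be enlarged to a set
    [Z] of columns on which every row is zero or mixed, with at least as many
    mixed rows as columns.  But no mixed row applies to points vanishing on [Z],
    so these points are connected by the other rows alone ([face_moves]); hence
    no vector of [L] is nonnegative and nonzero on [Z], whereas the mixed rows
    are numerous enough to be either dependent or combined to such a vector. *)

(** * Ideals and prime ideals *)

Section CommutativeAlgebra.
Variable R : comNzRingType.
Implicit Types (I J P : {pred R}) (S : R -> Prop).

(** Unlike in [idealr_closed], the unit ideal is allowed: properness of the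
    ideals generated below is a conclusion, drawn from what they avoid. *)
Definition is_ideal I := 0 \in I /\ forall a, {in I &, forall u v, a * u + v \in I}.

Lemma idealD I : is_ideal I -> {in I &, forall u v, u + v \in I}.
Proof. by case=> _ h u v uI vI; rewrite -[u]mul1r h. Qed.

Lemma idealM I : is_ideal I -> forall a, {in I, forall u, a * u \in I}.
Proof. by case=> h0 h a u uI; rewrite -[_ * _]addr0 h. Qed.

Lemma idealB I : is_ideal I -> {in I &, forall u v, u - v \in I}.
Proof. by case=> _ h u v uI vI; rewrite addrC -mulN1r h. Qed.

Lemma ideal_sum I (T : Type) (s : seq T) (Q : pred T) (F : T -> R) :
  is_ideal I -> (forall i, Q i -> F i \in I) -> \sum_(i <- s | Q i) F i \in I.
Proof.
move=> hI hF; elim/big_ind: _ => //; first by case: hI.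
by move=> x y; apply: idealD.
Qed.

Lemma prime_is_ideal P : prime_ideal P -> is_ideal P.
Proof. by case=> -[]. Qed.

Lemma ideal_gen_ideal S : is_ideal (ideal_gen S).
Proof.
split.
  apply/asboolP; exists 0%N, (fun=> 0), (fun=> 0); split; first by case.
  by rewrite big_ord0.
move=> a u v /asboolP[m1 [c1 [q1 [S1 ->]]]] /asboolP[m2 [c2 [q2 [S2 ->]]]].
apply/asboolP; exists (m1 + m2)%N.
exists (fun i => match split i with inl j => a * c1 j | inr j => c2 j end).
exists (fun i => match split i with inl j => q1 j | inr j => q2 j end).
split; first by move=> i; case: (split i).
rewrite big_split_ord /= mulr_sumr; congr (_ + _); apply: eq_bigr => i _.
  by rewrite -[lshift _ _]/(unsplit (inl i)) unsplitK mulrA.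
by rewrite -[rshift _ _]/(unsplit (inr i)) unsplitK.
Qed.

Lemma mem_ideal_gen S p : S p -> p \in ideal_gen S.
Proof.
move=> Sp; apply/asboolP; exists 1%N, (fun=> 1), (fun=> p); split=> //.
by rewrite big_ord1 mul1r.
Qed.

Lemma ideal_gen_min S I :
  is_ideal I -> (forall p, S p -> p \in I) -> {subset ideal_gen S <= I}.
Proof.
move=> hI hS p /asboolP[m [c [q [Sq ->]]]].
by apply: ideal_sum => // i _; apply: idealM => //; apply: hS.
Qed.

(** Krull's lemma: an ideal that is maximal among those disjoint from a
    multiplicative set is prime.  Every prime ideal below comes from it. *)
Lemma prime_avoiding I S :
  is_ideal I -> S 1 -> (forall x y, S x -> S y -> S (x * y)) ->
  (forall x, x \in I -> ~ S x) ->
  exists P, [/\ prime_ideal P, {subset I <= P} & forall x, x \in P -> ~ S x].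
Proof.
move=> hI S1 SM SI.
pose good J := [/\ is_ideal J, {subset I <= J} & forall x, x \in J -> ~ S x].
pose T := {J : {pred R} | good J}.
pose leT (s t : T) := `[< {subset sval s <= sval t} >].
have gI : good I by split.
have [|||[P gP] maxP] := @classical_sets.ZL_preorder T (exist _ I gI) leT.
- by move=> t; apply/asboolP.
- move=> r s t /asboolP rs /asboolP st; apply/asboolP => x xr; exact: st (rs _ xr).
- move=> A totA; have [[s0 As0]|A0] := pselect (exists s, A s); last first.
    by exists (exist _ I gI) => s As; case: A0; exists s.
  pose U : {pred R} := fun x => `[< exists2 s, A s & x \in sval s >].
  have gU : good U.
    split.
    - split; first by apply/asboolP; exists s0 => //; case: (svalP s0) => -[].
      move=> a u v /asboolP[s As us] /asboolP[t At vt]; apply/asboolP.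
      have [/asboolP st|/asboolP ts] := totA _ _ As At.
        by exists t => //; case: (svalP t) => -[_ h] _ _; apply: h => //; apply: st.
      by exists s => //; case: (svalP s) => -[_ h] _ _; apply: h => //; apply: ts.
    - move=> x xI; apply/asboolP; exists s0 => //.
      by case: (svalP s0) => _ h _; apply: h.
    - by move=> x /asboolP[s As]; case: (svalP s) => _ _ h; apply: h.
  exists (exist _ U gU) => s As; apply/asboolP => x xs.
  by apply/asboolP; exists s.
have [hP IP PS] := gP; exists P; split=> //.
have max u : u \notin P -> exists2 a, exists2 p, p \in P & S (a * u + p) & True.
  move=> uP; apply: contrapT => noS.
  pose J : {pred R} := fun x => `[< exists a, exists2 p, p \in P & x = a * u + p >].
  have PJ : {subset P <= J}.
    by move=> x xP; apply/asboolP; exists 0, x => //; rewrite mul0r add0r.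
  have gJ : good J.
    split.
    - split; first by apply: PJ; case: hP.
      move=> a x y /asboolP[b [p pP ->]] /asboolP[c [q qP ->]].
      apply/asboolP; exists (a * b + c), (a * p + q); first by case: hP => _; apply.
      by rewrite mulrDr mulrDl !mulrA addrACA.
    - by move=> x xI; apply/PJ/IP.
    - move=> x /asboolP[a [p pP ->]] Sx; apply: noS.
      by exists a => //; exists p.
  have /asboolP/(_ u) : leT (exist _ J gJ) (exist _ P gP).
    by apply: maxP; apply/asboolP.
  rewrite /= (negPf uP) => h; suff: false by []; apply: h.
  by apply/asboolP; exists 1, 0; [case: hP | rewrite mul1r addr0].
split.
  split; [by case: hP| |by case: hP].
  by apply/negP => /PS.
move=> u v uvP; apply: contrapT => /negP; rewrite negb_or => /andP[uP vP].
have [a [p pP Sp] _] := max _ uP; have [b [q qP Sq] _] := max _ vP.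
apply: (PS _ _ (SM _ _ Sp Sq)).
have -> : (a * u + p) * (b * v + q) = (a * b) * (u * v) + ((a * u + p) * q + (b * v) * p).
  rewrite mulrDr addrC addrCA; congr (_ + _).
  by rewrite mulrDl mulrACA (mulrC p) addrC addrC.
case: (hP) => _ h; apply: h => //; apply: idealD => //; exact: idealM.
Qed.

(** An element that is regular modulo [I] lies outside some prime ideal between
    [I] and [P]: this builds prime chains downwards, one regular element at a
    time. *)
Lemma prime_below I P f :
  is_ideal I -> prime_ideal P -> {subset I <= P} ->
  (forall g, f * g \in I -> g \in I) ->
  exists P', [/\ prime_ideal P', {subset I <= P'}, {subset P' <= P} & f \notin P'].
Proof.
move=> hI hP IP reg.
pose S x := exists2 g, g \notin P & exists k, x = f ^+ k * g.
have P1 : 1 \notin P by case: hP => -[].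
have [|||P' [hP' IP' SP']] := @prime_avoiding I S hI.
- by exists 1 => //; exists 0%N; rewrite mulr1.
- move=> _ _ [g gP [k ->]] [h hhP [l ->]]; exists (g * h).
    by apply/negP => /(proj2 hP)/orP[]; apply/negP.
  by exists (k + l)%N; rewrite exprD mulrACA.
- move=> x xI [g /negP gP [k def_x]]; apply/gP/IP; move: xI; rewrite {x}def_x => fgI.
  elim: k fgI => [|k ih]; first by rewrite expr0 mul1r.
  by rewrite exprS -mulrA => /reg.
exists P'; split=> //.
- move=> x xP'; apply: contrapT => /negP xP; apply: (SP' x xP').
  by exists x => //; exists 0%N; rewrite mul1r.
- by apply/negP => /SP'; apply; exists 1 => //; exists 1%N; rewrite mulr1.
Qed.

Lemma prime_chain_rcons k C P P' : prime_chain k C -> C k =i P' ->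
  prime_ideal P -> {subset P' <= P} -> ~ {subset P <= P'} ->
  exists2 C', prime_chain k.+1 C' & C' k.+1 =i P.
Proof.
move=> [pC sC] Ck hP sP nP.
exists (fun i => if (i <= k)%N then C i else P); last by rewrite ltnn.
split=> i hi; first by case: ifP => // /pC.
have ik : (i <= k)%N by [].
rewrite ik; case: ltnP => ik1; first exact: sC.
have -> : i = k by apply/eqP; rewrite eqn_leq ik.
split=> [x|h]; first by rewrite Ck; apply: sP.
by apply: nP => x /h; rewrite Ck.
Qed.

(** The upper ends of a longest chain provide the chains of all smaller
    lengths. *)
Lemma prime_heightI P h C : prime_chain h C -> C h =i P ->
  (forall k C', prime_chain k C' -> C' k =i P -> (k <= h)%N) -> prime_height P h.
Proof.
move=> [pC sC] Ch max k; split=> [[C' hC' C'k]|kh]; first exact: max C'k.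
exists (fun i => C (i + (h - k))%N); last by rewrite subnKC.
split=> i ik; first by apply: pC; lia.
by rewrite addSn; apply: sC; lia.
Qed.

End CommutativeAlgebra.

(** * Binomial ideals and congruences of monomials *)

Section ClassSums.
Variables (K : fieldType) (n : nat).
Implicit Types (E : pred 'X_{1..n}) (f g : {mpoly K[n]}).

(** For [E] ranging over the classes of a congruence, these functionals give the
    image of [f] in the algebra of the quotient monoid. *)
Definition class_sum E f := \sum_(m <- msupp f | E m) f@_m.

Lemma class_sum_widen E f s : uniq s -> {subset msupp f <= s} ->
  class_sum E f = \sum_(m <- s | E m) f@_m.
Proof.
move=> us sub; rewrite (bigID (mem (msupp f))) /= [X in _ + X]big1 ?addr0.
  rewrite /class_sum -[RHS]big_filter -[LHS]big_filter.
  apply: perm_big; apply: uniq_perm; rewrite ?filter_uniq ?msupp_uniq //.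
  move=> m; rewrite !mem_filter.
  by case: (boolP (m \in msupp f)) => [/sub ->|]; rewrite ?andbF ?andbT.
by move=> m /andP[_]; exact: memN_msupp_eq0.
Qed.

Lemma class_sum_is_scalar E : scalar (class_sum E).
Proof.
move=> c f g; pose s := undup (msupp (c *: f + g) ++ msupp f ++ msupp g).
have us : uniq s by exact: undup_uniq.
rewrite !(@class_sum_widen E _ s) //; first last.
- by move=> m; rewrite mem_undup !mem_cat => ->.
- by move=> m; rewrite mem_undup !mem_cat => ->; rewrite ?orbT.
- by move=> m; rewrite mem_undup !mem_cat => ->; rewrite ?orbT.
rewrite mulr_sumr -big_split; apply: eq_bigr => m _.
by rewrite mcoeffD mcoeffZ.
Qed.

HB.instance Definition _ E :=
  GRing.isLinear.Build K {mpoly K[n]} K *%R (class_sum E) (class_sum_is_scalar E).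

Lemma class_sumX E m : class_sum E 'X_[m] = (E m)%:R.
Proof.
rewrite /class_sum msuppX big_mkcond big_seq1 mcoeffX eqxx.
by case: (E m).
Qed.

Lemma eq_class_sum E E' f : E =1 E' -> class_sum E f = class_sum E' f.
Proof. by move=> eqE; apply: eq_bigl. Qed.

Lemma class_sum_linearE E f : class_sum E f = \sum_(m <- msupp f) f@_m * (E m)%:R.
Proof.
by rewrite {1}[f]mpolyE linear_sum; apply: eq_bigr => m _; rewrite linearZ /= class_sumX.
Qed.

Lemma class_sumXM E w f : class_sum E ('X_[w] * f) = class_sum (fun m => E (w + m)%MM) f.
Proof.
rewrite {1}[f]mpolyE mulr_sumr linear_sum [RHS]class_sum_linearE; apply: eq_bigr => m _.
by rewrite -scalerAr -mpolyXD linearZ /= class_sumX.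
Qed.

Definition congruence (E : 'X_{1..n} -> 'X_{1..n} -> Prop) :=
  [/\ forall u, E u u, forall u v, E u v -> E v u,
      forall v u w, E u v -> E v w -> E u w &
      forall w u v, E u v -> E (w + u)%MM (w + v)%MM].

Definition congr_binomial (E : 'X_{1..n} -> 'X_{1..n} -> Prop) (p : {mpoly K[n]}) :=
  exists u v, E u v /\ p = 'X_[u] - 'X_[v].

(** Modulo the ideal each monomial may be replaced by the chosen representative
    of its class; the coefficients that are then gathered at a representative
    are those of its class. *)
Lemma congr_idealP (E : 'X_{1..n} -> 'X_{1..n} -> Prop) f : congruence E ->
  f \in ideal_gen (congr_binomial E) <->
  forall u, class_sum (fun m => `[< E u m >]) f = 0.
Proof.
move=> [Er Es Et Ea]; have hI := @ideal_gen_ideal _ (congr_binomial E).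
split.
  move=> /asboolP[k [c [q [hq ->]]]] z; rewrite linear_sum big1 //= => i _.
  have [u [v [uv ->]]] := hq i.
  rewrite [c i]mpolyE mulr_suml linear_sum big1 //= => m _.
  rewrite -scalerAl linearZ /= mulrBr -!mpolyXD linearB /= !class_sumX.
  suff -> : `[< E z (m + u)%MM >] = `[< E z (m + v)%MM >] by rewrite subrr mulr0.
  by apply/asboolP/asboolP => h; apply: (Et _ _ _ h); apply: Ea => //; apply: Es.
move=> f0; pose rep m := choose (fun v => `[< E m v >]) m.
have repE m : E m (rep m).
  by apply/asboolP; apply: (@chooseP _ (fun v => `[< E m v >])); apply/asboolP.
have rep_eq u v : E u v -> rep u = rep v.
  move=> uv; rewrite /rep; have eqE : (fun w => `[< E u w >]) =1 (fun w => `[< E v w >]).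
    move=> w; apply/asboolP/asboolP; last exact: Et.
    by apply: Et; apply: Es.
  rewrite -(eq_choose eqE); apply: choose_id => //; apply/asboolP => //.
have -> : f = \sum_(m <- msupp f) f@_m *: ('X_[m] - 'X_[rep m]).
  rewrite (eq_bigr (fun m => f@_m *: 'X_[m] - f@_m *: 'X_[rep m])); last first.
    by move=> m _; rewrite scalerBr.
  rewrite sumrB -mpolyE [X in _ - X](_ : _ = 0) ?subr0 //; apply/mpolyP => z.
  rewrite mcoeff0 raddf_sum /=.
  have [[m <-]|nz] := pselect (exists m, rep m = z).
    rewrite -[RHS](f0 m) class_sum_linearE; apply: eq_bigr => v _.
    rewrite mcoeffZ mcoeffX; congr (_ * _%:R); congr nat_of_bool.
    apply/eqP/asboolP => [h|/rep_eq //].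
    by apply: (Et (rep m)) => //; rewrite -h; apply: Es.
  rewrite big1 // => m _; rewrite mcoeffZ mcoeffX; case: eqP => [h|]; last by rewrite mulr0.
  by case: nz; exists m.
apply: ideal_sum => // m _; rewrite -mul_mpolyC; apply: idealM => //.
by apply: mem_ideal_gen; exists m, (rep m).
Qed.

Lemma congr_binomialP (E : 'X_{1..n} -> 'X_{1..n} -> Prop) u v : congruence E ->
  'X_[u] - 'X_[v] \in ideal_gen (congr_binomial E) <-> E u v.
Proof.
move=> cE; split=> [|uv]; last by apply: mem_ideal_gen; exists u, v.
move=> /(congr_idealP _ cE)/(_ u); rewrite linearB /= !class_sumX.
case: cE => Er _ _ _; rewrite (asboolT (Er u)).
by case: asboolP => // _ /eqP; rewrite subr0 oner_eq0.
Qed.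

End ClassSums.

(** * Lattices in Z^n *)

Section IntegerLattices.
Variable n : nat.
Implicit Types (L : {pred 'rV[int]_n}) (u v w : 'rV[int]_n).

Definition nonneg w := forall j, 0 <= w 0 j.

Definition rowspan r (B : 'M[int]_(r, n)) : {pred 'rV[int]_n} :=
  [pred w | `[< exists c : 'rV[int]_r, w = c *m B >]].

Lemma rowspanP r (B : 'M[int]_(r, n)) w :
  reflect (exists c : 'rV[int]_r, w = c *m B) (w \in rowspan B).
Proof. exact: asboolP. Qed.

Lemma rowspan_closed r (B : 'M[int]_(r, n)) : zmod_closed (rowspan B).
Proof.
split; first by apply/rowspanP; exists 0; rewrite mul0mx.
move=> _ _ /rowspanP[c ->] /rowspanP[d ->]; apply/rowspanP; exists (c - d).
by rewrite mulmxBl.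
Qed.

Lemma row_rowspan r (B : 'M[int]_(r, n)) i : row i B \in rowspan B.
Proof. by apply/rowspanP; exists (delta_mx 0 i); rewrite -rowE. Qed.

Section Closed.
Variables (L : {pred 'rV[int]_n}) (hL : zmod_closed L).

Lemma lat0 : 0 \in L. Proof. by case: hL. Qed.

Lemma latB : {in L &, forall u v, u - v \in L}. Proof. by case: hL. Qed.

Lemma latN : {in L, forall u, - u \in L}.
Proof. by move=> u uL; rewrite -sub0r latB ?lat0. Qed.

Lemma latD : {in L &, forall u v, u + v \in L}.
Proof. by move=> u v uL vL; rewrite -[v]opprK latB ?latN. Qed.

Lemma lat_sum (T : Type) (s : seq T) (Q : pred T) (F : T -> 'rV[int]_n) :
  (forall i, Q i -> F i \in L) -> \sum_(i <- s | Q i) F i \in L.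
Proof. by move=> hF; elim/big_ind: _ => //; [exact: lat0 | exact: latD]. Qed.

Lemma latMn k : {in L, forall u, u *+ k \in L}.
Proof. by move=> u uL; elim: k => [|k ih]; rewrite ?lat0 // mulrS latD. Qed.

Lemma latZ (c : int) : {in L, forall u, c *: u \in L}.
Proof.
move=> u uL; case: c => k; first by rewrite -[Posz k]natz scaler_nat latMn.
by rewrite NegzE scaleNr -[Posz _]natz scaler_nat latN ?latMn.
Qed.

Lemma lat_mulmx r (B : 'M[int]_(r, n)) (c : 'rV[int]_r) :
  (forall i, row i B \in L) -> c *m B \in L.
Proof. by move=> hB; rewrite mulmx_sum_row; apply: lat_sum => i _; apply: latZ. Qed.

End Closed.

Lemma lattice_basis_rowspan r (B : 'M[int]_(r, n)) L :
  lattice_basis B L -> L =i rowspan B.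
Proof. by case=> h _ w; apply/idP/rowspanP => [/h|] // /h. Qed.

Lemma lattice_basis_row r (B : 'M[int]_(r, n)) L i :
  lattice_basis B L -> row i B \in L.
Proof. by move=> hB; rewrite (lattice_basis_rowspan hB) row_rowspan. Qed.

Lemma lattice_basis_unimodular r (T : 'M[int]_r) (B : 'M[int]_(r, n)) L :
  T \in unitmx -> lattice_basis B L -> lattice_basis (T *m B) L.
Proof.
move=> uT [hB iB]; split=> [w|c].
  rewrite hB; split=> [[c ->]|[c ->]]; last by exists (c *m T); rewrite mulmxA.
  by exists (c *m invmx T); rewrite mulmxA mulmxKV.
by rewrite mulmxA => /iB cT; rewrite -[c](mulmxK uT) cT mul0mx.
Qed.

(** A generating family with as many vectors as a basis is itself a basis: the
    two transition matrices are square, so they are inverse to each other. *)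
Lemma lattice_basis_of_generators r (B D : 'M[int]_(r, n)) L :
  lattice_basis B L -> L =i rowspan D -> lattice_basis D L.
Proof.
move=> hB hD; split=> [w|c cD].
  by rewrite hD; split => [/rowspanP|] // ?; apply/rowspanP.
have [X BX] : exists X, B = X *m D.
  have hX i : exists c : 'rV[int]_r, row i B = c *m D.
    by apply/rowspanP; rewrite -hD; apply: lattice_basis_row hB.
  have [X hXi] := choice hX; exists (\matrix_i X i).
  by apply/row_matrixP => i; rewrite row_mul rowK.
have [Y DY] : exists Y, D = Y *m B.
  have hX i : exists c : 'rV[int]_r, row i D = c *m B.
    by apply/rowspanP; rewrite -(lattice_basis_rowspan hB) hD row_rowspan.
  have [Y hYi] := choice hX; exists (\matrix_i Y i).
  by apply/row_matrixP => i; rewrite row_mul rowK.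
have [_ iB] := hB.
have XY : X *m Y = 1%:M.
  apply/row_matrixP => i; apply/eqP; rewrite -subr_eq0; apply/eqP/iB.
  by rewrite mulmxBl -!row_mul -mulmxA -DY -BX mul1mx subrr.
have YX := mulmx1C XY.
have cY : c *m Y = 0 by apply: iB; rewrite -mulmxA -DY.
by rewrite -[c]mulmx1 -YX mulmxA cY mul0mx.
Qed.

End IntegerLattices.

(** A rational relation exists by rank, and its denominators can be cleared. *)
Lemma int_row_dependent q z (A : 'M[int]_(q, z)) : (z < q)%N ->
  exists2 c : 'rV[int]_q, c != 0 & c *m A = 0.
Proof.
move=> zq; pose A' : 'M[rat]_(q, z) := map_mx intr A.
have /rowV0Pn[v /sub_kermxP vA v0] : kermx A' != 0.
  rewrite kermx_eq0 /row_free neq_ltn; apply/orP; left.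
  by apply: leq_ltn_trans (rank_leq_col A') zq.
pose d : int := \prod_i denq (v 0 i).
have d0 : d != 0 by apply/prodf_neq0 => i _; exact: denq_neq0.
pose c : 'rV[int]_q := \row_i (numq (v 0 i) * \prod_(j | j != i) denq (v 0 j)).
have cE : map_mx intr c = d%:~R *: v :> 'rV[rat]_q.
  apply/rowP => i; rewrite !mxE /d [in RHS](bigD1 i) //= !intrM numqE.
  by rewrite [RHS]mulrC mulrA.
exists c.
  apply: contra_neq v0 => c0; apply/rowP => i; move/rowP: cE => /(_ i).
  rewrite c0 !mxE rmorph0 => /esym/eqP; rewrite mulf_eq0 intr_eq0 (negPf d0).
  by move/eqP.
apply/rowP => j; apply: (@intr_inj rat).
have /rowP/(_ j) : map_mx intr (c *m A) = 0 :> 'rV[rat]_z.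
  by rewrite map_mxM cE -scalemxAl vA scaler0.
by rewrite !mxE rmorph0.
Qed.

(** The first coordinates of [L] form a subgroup of Z, generated by the smallest
    positive one [d]; a vector [w] attaining it completes a basis of the
    sublattice where the first coordinate vanishes. *)
Lemma lattice_basis_exists n (L : {pred 'rV[int]_n}) : zmod_closed L ->
  exists r (B : 'M[int]_(r, n)), lattice_basis B L.
Proof.
elim: n L => [|n ih] L hL.
  exists 0%N, 0; split=> [w|c _]; last by rewrite [c]thinmx0.
  by rewrite [w]thinmx0 lat0 //; split=> // _; exists 0; rewrite mul0mx.
pose L' : {pred 'rV[int]_n} := [pred u | row_mx (0 : 'rV_1) u \in L].
have [|r [B [hB iB]]] := ih L'.
  split; first by rewrite inE row_mx0 lat0.
  by move=> u v; rewrite !inE => uL vL; rewrite -[0]subr0 -add_row_mx -opp_row_mx latB.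
have tailL (u : 'rV[int]_(1 + n)) : u \in L -> u 0 0 = 0 ->
    exists c : 'rV[int]_r, u = c *m row_mx (0 : 'cV_r) B.
  move=> uL u0.
  have def_u : u = row_mx 0 (rsubmx u).
    rewrite -[LHS]hsubmxK; congr row_mx; apply/rowP => i; rewrite !mxE.
    by rewrite ord1 -[RHS]u0; congr (u _ _); apply/val_inj.
  have /hB[c hc] : rsubmx u \in L' by rewrite inE -def_u.
  by exists c; rewrite mul_mx_row mulmx0 -hc.
have tail_sub (c : 'rV[int]_r) : c *m row_mx (0 : 'cV_r) B \in L.
  by rewrite mul_mx_row mulmx0; change (c *m B \in L'); apply/hB; exists c.
have tail_inj (c : 'rV[int]_r) : c *m row_mx (0 : 'cV_r) B = 0 -> c = 0.
  by rewrite mul_mx_row -row_mx0 => /eq_row_mx[_ /iB].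
pose D d := (0 < d)%N && `[< exists2 w, w \in L & w 0 0 = d%:Z >].
have [exD|noD] := pselect (exists d, D d); last first.
  exists r, (row_mx (0 : 'cV_r) B); split=> [w|]; last exact: tail_inj.
  split=> [wL|[c ->]]; last exact: tail_sub.
  apply: tailL => //; apply: contrapT => /eqP w0; apply: noD.
  exists (absz (w 0 0)); rewrite /D absz_gt0 w0; apply/asboolP.
  have [wp|wn] := leP 0 (w 0 0); first by exists w => //; rewrite gez0_abs.
  by exists (- w); [rewrite latN | rewrite mxE ltz0_abs].
have [d /andP[d0 /asboolP[w wL wd]] dmin] := ex_minnP exD.
exists (1 + r)%N, (col_mx w (row_mx (0 : 'cV_r) B)); split=> [u|c].
  split=> [uL|[c ->]]; last first.
    by rewrite -[c]hsubmxK mul_row_col latD // mulmx_sum_row big_ord1 latZ // row_id.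
  pose x := u 0 0; pose q := (x %/ d)%Z.
  have u'L : u - q *: w \in L by rewrite latB ?latZ.
  have [|c hc] := tailL _ u'L.
    have e : (u - q *: w) 0 0 = (x %% d)%Z.
      by rewrite !mxE wd -/x {1}(divz_eq x d) addrAC subrr add0r.
    apply: contrapT => /eqP ne0.
    have m0 : 0 <= (x %% d)%Z by apply: modz_ge0; lia.
    have m1 : (x %% d)%Z < d by apply: ltz_pmod; lia.
    have := dmin (absz (x %% d)%Z); suff -> : D (absz (x %% d)%Z) by move/(_ isT); lia.
    rewrite /D absz_gt0 -{1}e ne0; apply/asboolP; exists (u - q *: w) => //.
    by rewrite e gez0_abs.
  exists (row_mx q%:M c); rewrite mul_row_col -hc mul_scalar_mx addrC subrK //.
rewrite -[c]hsubmxK mul_row_col => h.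
have l0 : lsubmx c = 0.
  have := congr1 (@lsubmx _ 1 1 n) h; rewrite raddfD /= -!mulmx_lsub row_mxKl mulmx0 addr0.
  rewrite [@lsubmx _ 1 1 n w]mx11_scalar mxE (_ : lshift n 0 = 0); last exact/val_inj.
  rewrite wd mul_mx_scalar raddf0 => /rowP/(_ 0); rewrite !mxE => e.
  by apply/rowP => i; rewrite ord1 !mxE; lia.
by move: h; rewrite l0 mul0mx add0r => /tail_inj ->; rewrite row_mx0.
Qed.

(** The coordinates of [w] in a basis have Smith form [(k, 0, .., 0)], which
    makes [w] a multiple of the first vector of another basis.  Up to sign this
    vector is positive at every coordinate where some vector of [L] is nonzero,
    so adding a large multiple of it to the other basis vectors makes them
    nonnegative. *)
Lemma nonneg_basis n (L : {pred 'rV[int]_n}) (w : 'rV[int]_n) :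
  zmod_closed L -> w \in L -> nonneg w ->
  (forall u j, u \in L -> w 0 j = 0 -> u 0 j = 0) ->
  exists r (B : 'M[int]_(r, n)), lattice_basis B L /\ forall i j, 0 <= B i j.
Proof.
move=> hL wL w0 wsupp; have [[|r] [V hV]] := lattice_basis_exists hL.
  by exists 0%N, V; split=> // -[].
have [hVL iV] := hV; have /hVL[c def_w] := wL.
have [T _ [S uS [d _ def_c]]] := int_Smith_normal_form c.
pose k := T 0 0 * d`_0.
have cS : c = k *: row 0 S.
  rewrite def_c [T]mx11_scalar mul_scalar_mx -scalemxAl -scalerA; congr (_ *: _).
  rewrite rowE scalemxAl; congr (_ *m _); apply/matrixP => i j.
  by rewrite !mxE !ord1 eqxx /= eq_sym mulr_natr.
pose V' := S *m V; have hV' : lattice_basis V' L by exact: lattice_basis_unimodular.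
have wV' j : w 0 j = k * V' 0 j.
  by rewrite def_w cS -scalemxAl -row_mul !mxE.
have supp0 j i : k * V' 0 j = 0 -> V' i j = 0.
  rewrite -wV' => /(wsupp _ _ (lattice_basis_row i hV')); by rewrite mxE.
have k0 : k != 0.
  apply/eqP => k0; have [_ /(_ (delta_mx 0 0))] := hV'.
  rewrite -rowE => e; have /matrixP/(_ 0 0) : delta_mx 0 0 = 0 :> 'rV[int]_r.+1.
    by apply: e; apply/rowP => j; rewrite mxE [RHS]mxE supp0 // k0 mul0r.
  by rewrite !mxE !eqxx.
pose s := sgz k; have sV j : 0 <= s * V' 0 j.
  have := w0 j; rewrite wV' /s.
  by case: sgzP k0 => // k0 _; rewrite ?mul1r ?mulN1r ?oppr_ge0; nia.
pose N : int := \sum_i \sum_j `|V' i j|.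
have leN i j : `|V' i j| <= N.
  rewrite /N (bigD1 i) //= (bigD1 j) //= -addrA ler_wpDr // addr_ge0 ?sumr_ge0 //.
  by move=> i' _; apply: sumr_ge0.
(* Row operations: multiply the first row by the sign [s], then add [N] times
   the result to the other rows. *)
pose U : 'M[int]_r.+1 := \matrix_(i, j)
  (if j == 0 then (if i == 0 then s else N * s) else (i == j)%:R).
have uU : U \in unitmx.
  rewrite unitmxE det_trig; last first.
    apply/is_trig_mxP => i j ij; rewrite mxE.
    have -> : (j == 0) = false by apply/negbTE; rewrite -val_eqE /=; lia.
    by rewrite (_ : i == j = false) //; apply/negbTE; rewrite -val_eqE /=; lia.
  rewrite big_ord_recl mxE eqxx big1 ?mulr1; last first.
    by move=> i _; rewrite mxE eqxx.
  by rewrite /s; case: sgzP k0.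
exists r.+1, (U *m V'); split; first exact: lattice_basis_unimodular.
move=> i j; rewrite mxE big_ord_recl mxE eqxx.
have [->|i0] := eqVneq i 0.
  by rewrite big1 ?addr0 // => l _; rewrite mxE /= mul0r.
have -> : \sum_(l < r) U i (lift ord0 l) * V' (lift ord0 l) j = V' i j.
  have [l def_i|e] := unliftP ord0 i; last by rewrite e eqxx in i0.
  rewrite (bigD1 l) //= -def_i mxE (negPf i0) eqxx mul1r big1 ?addr0 // => l' nl.
  rewrite mxE (_ : lift ord0 l' == 0 = false) // def_i (inj_eq lift_inj) eq_sym (negPf nl).
  by rewrite mul0r.
have := sV j; have := leN i j; rewrite -mulrA.
case: (eqVneq (s * V' 0 j) 0) => [e|].
  have -> : V' i j = 0; last by rewrite e mulr0.
  apply: supp0; have /eqP := e; rewrite mulf_eq0 => /orP[|/eqP ->]; last by rewrite mulr0.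
  by rewrite sgz_eq0 (negPf k0).
by move: (s * _) (V' i j) (N) => x y M; nia.
Qed.

(** * Lattice ideals *)

Section Monomials.
Variable n : nat.
Implicit Types (m : 'X_{1..n}) (w : 'rV[int]_n).

Definition mvec m : 'rV[int]_n := \row_i (m i)%:Z.

(** The exponent of the positive part; that of the negative part is [mpos (- w)]. *)
Definition mpos w : 'X_{1..n} := [multinom absz (Num.max (w 0 i) 0)%R | i < n].

Lemma mnm_diffE u v : mnm_diff u v = mvec u - mvec v.
Proof. by apply/rowP => i; rewrite !mxE. Qed.

Lemma mvecD u v : mvec (u + v)%MM = mvec u + mvec v.
Proof. by apply/rowP => i; rewrite !mxE mnmDE PoszD. Qed.

Lemma mvec_inj : injective mvec.
Proof. by move=> u v /rowP e; apply/mnmP => i; have := e i; rewrite !mxE => -[]. Qed.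

Lemma mvec_nonneg m : nonneg (mvec m).
Proof. by move=> j; rewrite mxE. Qed.

Lemma mposK w : nonneg w -> mvec (mpos w) = w.
Proof. by move=> h; apply/rowP => i; rewrite mxE mnmE; have := h i; lia. Qed.

Lemma mnm_diff_mpos w : mnm_diff (mpos w) (mpos (- w)) = w.
Proof.
apply/rowP => i; rewrite mxE !mnmE mxE.
by move: (w 0 i) => x; lia.
Qed.

Definition lattice_congr (L : {pred 'rV[int]_n}) u v := mnm_diff u v \in L.

Lemma lattice_congruence L : zmod_closed L -> congruence (lattice_congr L).
Proof.
move=> hL; rewrite /lattice_congr; split=> [u|u v|v u w|w u v]; rewrite !mnm_diffE.
- by rewrite subrr lat0.
- by move=> uv; rewrite -opprB latN.
- by move=> uv vw; rewrite -(subrK (mvec v) (mvec u)) -addrA latD.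
- by rewrite !mvecD opprD addrACA subrr add0r.
Qed.

End Monomials.

Section LatticeIdeal.
Variables (K : fieldType) (n : nat).
Implicit Types (L : {pred 'rV[int]_n}) (f g : {mpoly K[n]}) (z w : 'rV[int]_n).

Lemma lattice_ideal_ideal L : is_ideal (lattice_ideal K L).
Proof. exact: ideal_gen_ideal. Qed.

Lemma lattice_ideal_binomial L u v : mnm_diff u v \in L ->
  'X_[u] - 'X_[v] \in lattice_ideal K L.
Proof. by move=> uv; apply: mem_ideal_gen; exists u, v. Qed.

Definition coset_sum L z f := class_sum (fun m => z - mvec m \in L) f.

(** Here [z] ranges over Z^n and not only over exponents: the lattice ideal is the
    kernel of the map to the group algebra of Z^n/L, where monomials are
    invertible.  This freedom to translate is what [binomial_regular] needs. *)
Lemma lattice_idealP L f : zmod_closed L ->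
  f \in lattice_ideal K L <-> forall z, coset_sum L z f = 0.
Proof.
move=> hL; have cE := lattice_congruence hL; split=> [fI z|f0]; last first.
  apply/(congr_idealP _ cE) => u; rewrite -[RHS](f0 (mvec u)).
  by apply: eq_class_sum => m; rewrite /lattice_congr mnm_diffE asboolb.
have [[m zm]|no] := pselect (exists m, z - mvec m \in L); last first.
  by rewrite /coset_sum /class_sum big1 // => m zm; case: no; exists m.
move/(congr_idealP _ cE): fI => /(_ m) <-; apply: eq_class_sum => m'.
rewrite /lattice_congr mnm_diffE asboolb; apply/idP/idP => h.
  have -> : mvec m - mvec m' = (z - mvec m') - (z - mvec m).
    by rewrite opprB [RHS]addrC addrA subrK.
  exact: latB.
by rewrite -(subrK (mvec m) z) -addrA latD.
Qed.

Lemma lattice_ideal_sub L L' : {subset L <= L'} ->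
  {subset lattice_ideal K L <= lattice_ideal K L'}.
Proof.
move=> LL'; apply: ideal_gen_min; first exact: lattice_ideal_ideal.
by move=> p [u [v [uv ->]]]; apply/lattice_ideal_binomial/LL'.
Qed.

(** If [w = mnm_diff a b] has infinite order modulo [L], the coset sums of a
    multiplier [g] are invariant under translation by [w]; only finitely many of
    them are nonzero, so all vanish. *)
Lemma binomial_regular L a b g : zmod_closed L ->
  (forall k, (0 < k)%N -> mnm_diff a b *+ k \notin L) ->
  ('X_[a] - 'X_[b]) * g \in lattice_ideal K L -> g \in lattice_ideal K L.
Proof.
set w := mnm_diff a b => hL w_inf /(lattice_idealP _ hL) h.
have shift z : coset_sum L z g = coset_sum L (z + w) g.
  have := h (z + mvec a); rewrite /coset_sum mulrBl linearB /= !class_sumXM.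
  move/eqP; rewrite subr_eq0 => /eqP e.
  transitivity (class_sum (fun m => z + mvec a - mvec (a + m)%MM \in L) g).
    by apply: eq_class_sum => m; rewrite mvecD opprD addrA addrK.
  rewrite e; apply: eq_class_sum => m.
  by rewrite mvecD opprD /w mnm_diffE !addrA [_ - mvec m]addrAC.
have shifts k z : coset_sum L z g = coset_sum L (z + w *+ k) g.
  by elim: k z => [|k ih] z; rewrite ?addr0 // ih shift -addrA -mulrSr.
apply/(lattice_idealP _ hL) => z; apply: contrapT => /eqP ne0.
have hit k : exists i : 'I_(size (msupp g)), z + w *+ k - mvec (nth 0%MM (msupp g) i) \in L.
  apply: contrapT => no; move: ne0; rewrite (shifts k) => /eqP; apply.
  rewrite /coset_sum /class_sum big_seq_cond big1 // => m /andP[mg zm].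
  case: no; have im : (index m (msupp g) < size (msupp g))%N by rewrite index_mem.
  by exists (Ordinal im); rewrite /= nth_index.
have [i hi] := choice hit.
have /injectivePn[k [k' nk e]] : ~~ injectiveb (fun k : 'I_(size (msupp g)).+1 => i k).
  by apply/negP => /injectiveP/leq_card; rewrite !card_ord ltnn.
wlog kk' : k k' nk e / (k' < k)%N.
  move=> H; have [kk'|k'k|/val_inj/eqP] := ltngtP k k'; last by rewrite (negPf nk).
    by apply: (H k' k); rewrite // eq_sym.
  exact: (H k k').
have /negP := w_inf (k - k')%N (etrans (subn_gt0 _ _) kk'); apply.
have := latB hL (hi k) (hi k'); rewrite e.
by rewrite opprB addrA subrK opprD addrACA subrr add0r -mulrnBr // ltnW.
Qed.

(** The binomials of a basis form a regular sequence modulo the ideals of the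
    partial spans, which yields a chain of primes descending from [P]. *)
Lemma lattice_prime_chain r (B : 'M[int]_(r, n)) P :
  (forall c : 'rV[int]_r, c *m B = 0 -> c = 0) -> prime_ideal P ->
  {subset lattice_ideal K (rowspan B) <= P} ->
  exists2 C, prime_chain r C & C r =i P.
Proof.
elim: r B P => [|r ih] B P iB hP IP; first by exists (fun=> P).
pose w := @usubmx _ 1 r n B; pose B' := @dsubmx _ 1 r n B.
have def_B : B = @col_mx _ 1 r n w B' by exact: esym (@vsubmxK _ 1 r n B).
have mulB (x : 'rV[int]_1) (c : 'rV[int]_r) :
    row_mx x c *m (B : 'M_(1 + r, n)) = x *m w + c *m B'.
  by rewrite def_B mul_row_col.
have sB' : {subset rowspan B' <= rowspan B}.
  move=> _ /rowspanP[c ->]; apply/rowspanP; exists (row_mx (0 : 'rV_1) c).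
  by rewrite mulB mul0mx add0r.
have wB : w \in rowspan B.
  apply/rowspanP; exists (row_mx (1%:M : 'rV_1) (0 : 'rV_r)).
  by rewrite mulB mul1mx mul0mx addr0.
have hB' := rowspan_closed B'.
have sI := lattice_ideal_sub sB'.
pose f : {mpoly K[n]} := 'X_[mpos w] - 'X_[mpos (- w)].
have fP : f \in P by apply/IP/lattice_ideal_binomial; rewrite mnm_diff_mpos.
have [|||g|P' [hP' IP' sP' fP']] := @prime_below _ (lattice_ideal K (rowspan B')) P f.
- exact: lattice_ideal_ideal.
- by [].
- by move=> x /sI/IP.
- apply: binomial_regular => // k k0; rewrite mnm_diff_mpos.
  apply/negP => /rowspanP[c wc].
  have /(_ (row_mx (k%:R%:M : 'rV_1) (- c))) := iB.
  rewrite mulB mulNmx -wc mul_scalar_mx scaler_nat subrr => /(_ erefl).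
  move/(congr1 (@lsubmx _ 1 1 r)); rewrite row_mxKl raddf0 => /rowP/(_ 0).
  by rewrite !mxE eqxx => /eqP; rewrite mulr1n natz eqz_nat; lia.
have [|C hC CP'] := ih B' P' _ hP' IP'.
  move=> c cB'; have := iB (row_mx (0 : 'rV_1) c); rewrite mulB mul0mx add0r => /(_ cB').
  by move/(congr1 (@rsubmx _ 1 1 r)); rewrite row_mxKr raddf0.
apply: (prime_chain_rcons hC CP' hP sP') => PP'.
by rewrite PP' in fP'.
Qed.
End LatticeIdeal.

(** * The height of a lattice ideal *)

Section FreeFamilies.
Variables (K : fieldType) (n : nat).
Implicit Types (C : {pred {mpoly K[n]}}) (f : {mpoly K[n]}) (T : finType).

(** Linear independence of the classes modulo [C]. *)
Definition free_mod C T (h : T -> {mpoly K[n]}) :=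
  forall c : T -> K, \sum_e c e *: h e \in C -> forall e, c e = 0.

Definition deg_le d f := (msize f <= d.+1)%N.

Lemma deg_leM d e f g : deg_le d f -> deg_le e g -> deg_le (d + e) (f * g).
Proof.
rewrite /deg_le; have [->|f0] := eqVneq f 0; first by rewrite mul0r msize0.
have [->|g0] := eqVneq g 0; first by rewrite mulr0 msize0.
rewrite msizeM //; move: (msize f) (msize g) => a b; lia.
Qed.

Lemma deg_leX d f k s : (k <= s)%N -> deg_le d f -> deg_le (s * d) (f ^+ k).
Proof.
elim: k s => [|k ih] s ks df; first by rewrite /deg_le expr0 msize1.
by case: s ks => // s ks; rewrite exprS mulSn deg_leM // ih.
Qed.

(** Going down one step in a prime chain, an element [f] separating the two primes
    behaves like a new variable over the family: modulo [C1] only the constant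
    coefficient of a polynomial in [f] survives, and when that vanishes a factor
    [f] can be cancelled modulo [C0]. *)
Lemma free_mod_powers C0 C1 f T (h : T -> {mpoly K[n]}) s :
  prime_ideal C0 -> prime_ideal C1 -> {subset C0 <= C1} -> f \in C1 -> f \notin C0 ->
  free_mod C1 h -> free_mod C0 (fun p : 'I_s * T => f ^+ p.1 * h p.2).
Proof.
move=> p0 p1 s01 f1 f0 fr c.
have -> : \sum_p c p *: (f ^+ p.1 * h p.2) = \sum_(a < s) f ^+ a * \sum_e c (a, e) *: h e.
  under [RHS]eq_bigr => a _ do rewrite mulr_sumr.
  rewrite pair_bigA; apply: eq_bigr => -[a e] _ /=.
  by rewrite scalerAr.
suff main (c' : 'I_s -> T -> K) :
    \sum_(a < s) f ^+ a * \sum_e c' a e *: h e \in C0 -> forall a e, c' a e = 0.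
  by move=> /(main (fun a e => c (a, e))) c0 [a e]; apply: c0.
have i0 := prime_is_ideal p0; have i1 := prime_is_ideal p1.
elim: s c' {c} => [|s ih] c'; first by move=> _ [].
rewrite big_ord_recl expr0 mul1r.
have -> : \sum_(a < s) f ^+ lift ord0 a * \sum_e c' (lift ord0 a) e *: h e =
          f * \sum_(a < s) f ^+ a * \sum_e c' (lift ord0 a) e *: h e.
  by rewrite mulr_sumr; apply: eq_bigr => a _; rewrite exprS mulrA.
set g := \sum_(a < s) _ => hC0.
have c0 : forall e, c' ord0 e = 0.
  apply: fr; have := idealB i1 (s01 _ hC0) (idealM i1 g f1).
  by rewrite [g * f]mulrC addrK.
have gC0 : g \in C0.
  move: hC0; rewrite big1 => [|e _]; last by rewrite c0 scale0r.
  by rewrite add0r => /(proj2 p0); rewrite (negPf f0).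
move=> a e; have [b ->|->] := unliftP ord0 a; last exact: c0.
exact: (ih (fun a => c' (lift ord0 a))).
Qed.

(** In degree at most [d], a polynomial has at most [d.+1 ^ n] coefficients. *)
Lemma card_free_family C T (h : T -> {mpoly K[n]}) d :
  0 \in C -> free_mod C h -> (forall e, deg_le d (h e)) -> (#|T| <= d.+1 ^ n)%N.
Proof.
move=> C0 fr hd; rewrite leqNgt; apply/negP => lt.
pose mon (x : {ffun 'I_n -> 'I_d.+1}) : 'X_{1..n} := [multinom (x i : nat) | i < n].
pose A : 'M[K]_(#|T|, #|{: {ffun 'I_n -> 'I_d.+1}}|) :=
  \matrix_(i, j) (h (enum_val i))@_(mon (enum_val j)).
have /rowV0Pn[v /sub_kermxP vA /eqP] : kermx A != 0.
  rewrite kermx_eq0 /row_free neq_ltn; apply/orP; left.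
  apply: leq_ltn_trans (rank_leq_col A) _.
  by rewrite card_ffun !card_ord.
apply; apply/rowP => i; rewrite mxE -[i]enum_valK.
apply: (fr (fun e => v 0 (enum_rank e))).
suff -> : \sum_e v 0 (enum_rank e) *: h e = 0 by [].
apply/mpolyP => m; rewrite mcoeff0 raddf_sum /=.
have [/existsP[j mj]|/existsPn small] := boolP [exists j, (d < m j)%N].
  rewrite big1 // => e _; rewrite mcoeffZ memN_msupp_eq0 ?mulr0 //.
  apply: msize_mdeg_ge; apply: leq_trans (hd e) _; apply: leq_trans mj _.
  by rewrite mdegE (bigD1 j) //= leq_addr.
pose x := [ffun j => inord (m j) : 'I_d.+1].
have mx : mon x = m.
  by apply/mnmP => j; rewrite mnmE ffunE inordK // ltnS leqNgt small.
move/rowP: vA => /(_ (enum_rank x)); rewrite !mxE.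
rewrite (reindex enum_rank) /=; last by exists enum_val => ? _; rewrite ?enum_valK ?enum_rankK.
by move=> vA; rewrite -[RHS]vA; apply: eq_bigr => e _; rewrite mxE !enum_rankK mx mcoeffZ.
Qed.

(** Iteration of [free_mod_powers] down a chain.  It matters that [D] does not
    depend on [s]: the degrees grow linearly in [s], the family like [s ^ k]. *)
Lemma prime_chain_free k (C : nat -> {pred {mpoly K[n]}}) : prime_chain k C ->
  exists D, forall s T (h : T -> {mpoly K[n]}) d,
    free_mod (C k) h -> (forall e, deg_le d (h e)) ->
    exists (T' : finType) (h' : T' -> {mpoly K[n]}),
      [/\ #|T'| = (s ^ k * #|T|)%N, free_mod (C 0%N) h' &
          forall e, deg_le (d + s * D) (h' e)].
Proof.
elim: k => [|k ih] hC.
  exists 0%N => s T h d fr hd; exists T, h; split=> //; first by rewrite mul1n.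
  by move=> e; rewrite muln0 addn0.
have [pC sC] := hC.
have [|D hD] := ih.
  by split=> i ik; [apply: pC; apply: leqW | apply: sC; apply: ltnW].
have [sub nsub] := sC k (leqnn _).
have [f f1 f0] : exists2 f, f \in C k.+1 & f \notin C k.
  apply: contrapT => no; apply: nsub => x x1; apply: contrapT => /negP x0.
  by apply: no; exists x.
exists (msize f + D)%N => s T h d fr hd.
have fr' := free_mod_powers (s := s) (pC k (leqnSn k)) (pC k.+1 (leqnn _)) sub f1 f0 fr.
have [|T' [h' [cT' frh' hd']]] := hD s _ _ (s * msize f + d)%N fr'.
  move=> [a e]; apply: deg_leM; last exact: hd.
  by apply: deg_leX (ltnW (ltn_ord a)) _; rewrite /deg_le.
exists T', h'; split=> //; first by rewrite cT' card_prod card_ord expnSr mulnA.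
by move=> e; have := hd' e; rewrite mulnDr addnA (addnC d).
Qed.

Definition vars_in (Y : {set 'I_n}) f :=
  forall m, m \in msupp f -> forall j, j \notin Y -> m j = 0%N.

Lemma free_mod_monomials (P : {pred {mpoly K[n]}}) (Y : {set 'I_n}) s :
  (forall p, p \in P -> ~ (p != 0 /\ vars_in Y p)) ->
  exists h : {ffun {j | j \in Y} -> 'I_s} -> {mpoly K[n]},
    free_mod P h /\ forall e, deg_le (n * s) (h e).
Proof.
move=> PY; pose mon (e : {ffun {j | j \in Y} -> 'I_s}) : 'X_{1..n} :=
  [multinom oapp (fun i => e i : nat) 0%N (insub j : option {j | j \in Y}) | j < n].
have monY e j : j \notin Y -> mon e j = 0%N by move=> jY; rewrite mnmE insubN.
have mon_inj : injective mon.
  move=> e e' /mnmP em; apply/ffunP => -[j jY]; apply/val_inj.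
  by have := em j; rewrite !mnmE insubT.
exists (fun e => 'X_[mon e]); split=> [c cP e|e]; last first.
  rewrite /deg_le msizeX ltnS mdegE -[X in (X * _)%N](card_ord n) -sum_nat_const.
  apply: leq_sum => j _; rewrite mnmE; case: insub => //= i; exact: ltnW.
set p := \sum_e _ in cP; have cE e' : p@_(mon e') = c e'.
  rewrite raddf_sum (bigD1 e') //= mcoeffZ mcoeffX eqxx mulr1 big1 ?addr0 // => e'' ne.
  by rewrite mcoeffZ mcoeffX (inj_eq mon_inj) (negPf ne) mulr0.
rewrite -cE; suff -> : p = 0 by rewrite mcoeff0.
apply: contrapT => /eqP p0; apply: (PY p cP); split=> // m /msupp_sum_le.
move=> /flattenP[_ /mapP[e' _ ->]] /msuppZ_le; rewrite msuppX inE => /eqP -> j.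
exact: monY.
Qed.

(** The chain and the variables in [Y] provide [s ^ (k + #|Y|)] free elements of
    degree linear in [s], while polynomials of such degrees form a space of
    dimension [O(s ^ n)]. *)
Lemma prime_chain_bound k (C : nat -> {pred {mpoly K[n]}})
    (P : {pred {mpoly K[n]}}) (Y : {set 'I_n}) :
  prime_chain k C -> C k =i P ->
  (forall p, p \in P -> ~ (p != 0 /\ vars_in Y p)) ->
  (k + #|Y| <= n)%N.
Proof.
move=> hC CP PY; have [D hD] := prime_chain_free hC.
rewrite leqNgt; apply/negP => nk.
(* The degrees below are less than [s * E], and [s] is chosen so that
   [s ^ n.+1] exceeds [(s * E) ^ n]. *)
pose E := (n + D).+1; pose s := (E ^ n).+1.
have [h [fr hd]] := @free_mod_monomials P Y s PY.
have [|T' [h' [cT' fr' hd']]] := hD s _ h (n * s)%N _ hd.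
  by move=> c; rewrite CP; apply: fr.
have := card_free_family _ fr' hd'.
have -> : 0 \in C 0%N by have [pC _] := hC; case: (prime_is_ideal (pC 0%N (leq0n _))).
move=> /(_ isT); rewrite cT' card_ffun card_ord card_sig -expnD.
apply/negP; rewrite -ltnNge.
apply: (@leq_ltn_trans ((s * E) ^ n)%N).
  have : ((n * s + s * D).+1 <= s * E)%N by rewrite /E /s; nia.
  by move: (_.+1) (s * E)%N => a b; case: (n) => // n' ab; rewrite leq_exp2r.
apply: (@leq_trans (s ^ n.+1)%N); last by rewrite leq_exp2l // /s ltnS expn_gt0.
by rewrite expnMn expnS mulnC ltn_pmul2r // expn_gt0.
Qed.

End FreeFamilies.

(** A maximal [Y] works: each coordinate outside of [Y] comes with a vector of [L]
    that is nonzero there and vanishes at the other coordinates outside of [Y],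
    and these vectors are independent. *)
Lemma free_coordinates n r (B : 'M[int]_(r, n)) (L : {pred 'rV[int]_n}) :
  zmod_closed L -> lattice_basis B L ->
  exists Y : {set 'I_n}, (n <= #|Y| + r)%N /\
    forall u, u \in L -> (forall j, j \notin Y -> u 0 j = 0) -> u = 0.
Proof.
move=> hL [hB _].
pose free (Y : {set 'I_n}) :=
  `[< forall u, u \in L -> (forall j, j \notin Y -> u 0 j = 0) -> u = 0 >].
have [|Y /maxsetP[/asboolP freeY maxY]] := @ex_maxset _ free.
  by exists set0; apply/asboolP => u _ u0; apply/rowP => j; rewrite mxE u0 ?inE.
exists Y; split=> //; rewrite leqNgt; apply/negP => lt.
have hu (i : 'I_#|~: Y|) : exists c : 'rV[int]_r,
    (c *m B) 0 (enum_val i) != 0 /\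
    forall j, j \notin Y -> j != enum_val i -> (c *m B) 0 j = 0.
  have iY : enum_val i \notin Y by have := enum_valP i; rewrite inE.
  apply: contrapT => no; suff /maxY e : free (enum_val i |: Y).
    by have := setU11 (enum_val i) Y; rewrite (e (subsetUr _ _)) (negPf iY).
  apply/asboolP => u uL u0; apply: (freeY _ uL) => j jY.
  have [->|ne] := eqVneq j (enum_val i); last by apply: u0; rewrite !inE negb_or ne.
  apply: contrapT => /eqP ui; have /hB[c def_u] := uL; apply: no.
  exists c; rewrite -def_u; split=> // l lY li; apply: u0.
  by rewrite !inE negb_or li.
have [c hc] := choice hu; pose X : 'M[int]_(#|~: Y|, r) := \matrix_i c i.
have [|a a0 aX] := int_row_dependent X.
  by have := cardsC Y; rewrite card_ord; lia.
case/eqP: a0; apply/rowP => i; rewrite mxE.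
have /rowP/(_ (enum_val i)) : a *m X *m B = 0 by rewrite aX mul0mx.
rewrite -mulmxA mxE (bigD1 i) //= big1 => [|l li]; last first.
  have -> : (X *m B) l (enum_val i) = (c l *m B) 0 (enum_val i).
    by rewrite -[c l](rowK c) -row_mul [RHS]mxE.
  have [_ ->] := hc l; rewrite ?mulr0 ?(inj_eq enum_val_inj) // 1?eq_sym //.
  by have := enum_valP i; rewrite inE.
have -> : (X *m B) i (enum_val i) = (c i *m B) 0 (enum_val i).
  by rewrite -[c i](rowK c) -row_mul [RHS]mxE.
have [ne _] := hc i.
by rewrite addr0 [RHS]mxE => /eqP; rewrite mulf_eq0 (negPf ne) orbF => /eqP.
Qed.

(** A prime over the lattice ideal that avoids the nonzero polynomials in the
    variables [Y] has height exactly [r]: distinct monomials in these variables are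
    not congruent modulo [L]. *)
Lemma lattice_ideal_height (K : fieldType) n r (B : 'M[int]_(r, n)) (L : {pred 'rV[int]_n}) :
  zmod_closed L -> lattice_basis B L -> ideal_height (lattice_ideal K L) r.
Proof.
move=> hL hB; have [_ iB] := hB.
have IB : {subset lattice_ideal K (rowspan B) <= lattice_ideal K L}.
  by apply: lattice_ideal_sub => u; rewrite (lattice_basis_rowspan hB).
split; last first.
  move=> P h hP IP hPh; have [C hC CP] := lattice_prime_chain iB hP (fun x xI => IP x (IB x xI)).
  by apply/(hPh r); exists C.
have [Y [nY freeY]] := free_coordinates hL hB.
pose S (p : {mpoly K[n]}) := p != 0 /\ vars_in Y p.
have [|||P [hP IP PS]] := @prime_avoiding _ (lattice_ideal K L) S (lattice_ideal_ideal K L).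
- split; first exact: oner_neq0.
  by move=> m; rewrite msupp1 inE => /eqP -> j _; rewrite mnm0E.
- move=> p q [p0 hp] [q0 hq]; split; first by rewrite mulf_neq0.
  move=> m /msuppM_le/allpairsP[[m1 m2] /= [m1p m2q ->]] j jY.
  by rewrite mnmDE hp ?hq.
- move=> p pI [p0 hp]; case/eqP: p0; apply/mpolyP => m; rewrite mcoeff0.
  have [mp|/memN_msupp_eq0 //] := boolP (m \in msupp p).
  move/(lattice_idealP _ hL): pI => /(_ (mvec m)) => e; rewrite -[RHS]e.
  rewrite /coset_sum /class_sum big_mkcond (bigD1_seq m) ?msupp_uniq //=.
  rewrite subrr lat0 // big1_seq ?addr0 // => m' /andP[ne m'p]; case: ifP => // mm'.
  have /mvec_inj e' : mvec m = mvec m'; last by rewrite e' eqxx in ne.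
  apply/eqP; rewrite -subr_eq0; apply/eqP/freeY => // j jY.
  by rewrite !mxE hp // hp // subrr.
exists P; split=> //.
have [C hC CP] := lattice_prime_chain iB hP (fun x xI => IP x (IB x xI)).
apply: prime_heightI hC CP _ => k C' hC' CP'.
by have := prime_chain_bound hC' CP' PS; lia.
Qed.

Lemma ideal_height_uniq (R : comNzRingType) (I : {pred R}) r r' :
  ideal_height I r -> ideal_height I r' -> r = r'.
Proof.
move=> [[P [hP IP Pr]] mr] [[P' [hP' IP' Pr']] mr'].
by apply/eqP; rewrite eqn_leq (mr P') // (mr' P).
Qed.

(** * Connecting lattice points by moves *)

Section Moves.
Variable n : nat.
Implicit Types (S : 'rV[int]_n -> 'rV[int]_n -> Prop) (u v w x y : 'rV[int]_n).

Lemma nonnegD u v : nonneg u -> nonneg v -> nonneg (u + v).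
Proof. by move=> hu hv j; rewrite mxE addr_ge0. Qed.

(** The congruence generated by [S]; symmetry and transitivity are built in so
    that invariants of moves can be proved by a plain induction. *)
Inductive conn S : 'rV[int]_n -> 'rV[int]_n -> Prop :=
| conn_refl u : conn S u u
| conn_sym u v : conn S u v -> conn S v u
| conn_trans v u w : conn S u v -> conn S v w -> conn S u w
| conn_move w a b : S a b -> nonneg w -> conn S (w + a) (w + b).

Lemma conn_shift S w u v : nonneg w -> conn S u v -> conn S (w + u) (w + v).
Proof.
move=> hw; elim=> [x|x y _|y x z _ h1 _ h2|x a b Sab hx].
- exact: conn_refl.
- exact: conn_sym.
- exact: conn_trans h2.
- by rewrite !addrA; apply: conn_move => //; apply: nonnegD.
Qed.

Definition generates S (L : {pred 'rV[int]_n}) :=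
  forall u v, nonneg u -> nonneg v -> u - v \in L -> conn S u v.

Definition monomial_moves r (a b : 'I_r -> 'X_{1..n}) x y :=
  exists i, x = mvec (a i) /\ y = mvec (b i).

(** Equality of a lattice ideal with an ideal of binomials only concerns the
    two congruences of monomials; the coefficient field disappears. *)
Lemma lattice_ideal_generated (K : fieldType) (L : {pred 'rV[int]_n}) r
    (a b : 'I_r -> 'X_{1..n}) : zmod_closed L ->
  lattice_ideal K L =i ideal_gen (fun p => exists i, p = 'X_[a i] - 'X_[b i]) <->
  (forall i, mnm_diff (a i) (b i) \in L) /\ generates (monomial_moves a b) L.
Proof.
move=> hL; set I := ideal_gen _; have hI : is_ideal I by exact: ideal_gen_ideal.
have cL := lattice_congruence hL.
pose E (u v : 'X_{1..n}) := conn (monomial_moves a b) (mvec u) (mvec v).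
have cE : congruence E.
  split=> [u|u v|v u w|w u v]; rewrite /E.
  - exact: conn_refl.
  - exact: conn_sym.
  - exact: conn_trans.
  - by move=> uv; rewrite !mvecD; apply: conn_shift => //; apply: mvec_nonneg.
have connI x y : conn (monomial_moves a b) x y -> 'X_[mpos x] - 'X_[mpos y] \in I.
  elim=> {x y} [x|x y _ h|y x z _ h1 _ h2|w _ _ [i [-> ->]] hw].
  - by rewrite subrr; case: hI.
  - by rewrite -opprB -mulN1r idealM.
  - by rewrite -(subrK 'X_[mpos y] 'X_[mpos x]) -addrA idealD.
  - have mD m : mpos (w + mvec m) = (mpos w + m)%MM.
      apply: mvec_inj; rewrite mvecD !mposK //.
      by apply: nonnegD => //; apply: mvec_nonneg.
    by rewrite !mD !mpolyXD -mulrBr idealM //; apply: mem_ideal_gen; exists i.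
split=> [LI|[abL gen] p].
  split=> [i|u v hu hv uv].
    apply/(congr_binomialP K _ _ cL); rewrite -/(lattice_ideal K L) LI.
    by apply: mem_ideal_gen; exists i.
  rewrite -[u]mposK // -[v]mposK //; apply/(congr_binomialP K (mpos u) (mpos v) cE).
  have : 'X_[mpos u] - 'X_[mpos v] \in lattice_ideal K L.
    by apply: lattice_ideal_binomial; rewrite mnm_diffE !mposK.
  rewrite LI; apply: ideal_gen_min; first exact: ideal_gen_ideal.
  move=> _ [i ->]; apply/(congr_binomialP K _ _ cE).
  rewrite /E -[mvec (a i)]add0r -[mvec (b i)]add0r; apply: conn_move; first by exists i.
  by move=> j; rewrite mxE.
apply/idP/idP; last first.
  apply: ideal_gen_min; first exact: lattice_ideal_ideal.
  by move=> _ [i ->]; apply: lattice_ideal_binomial.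
apply: ideal_gen_min => // _ [u [v [uv ->]]].
have mK m : mpos (mvec m) = m by apply: mvec_inj; rewrite mposK //; apply: mvec_nonneg.
rewrite -[u]mK -[v]mK; apply: connI; apply: gen; try exact: mvec_nonneg.
by rewrite -mnm_diffE.
Qed.

End Moves.

(** * Coordinates outside of sigma *)

Section Sigma.
Variables (n : nat) (L : {pred 'rV[int]_n}) (hL : zmod_closed L).
Implicit Types (u w : 'rV[int]_n).

Lemma sigma_vector : exists w, [/\ w \in L, nonneg w,
  forall j, j \in sigma L -> 0 < w 0 j & forall j, j \notin sigma L -> w 0 j = 0].
Proof.
have hw (j : 'I_n) : exists w, [/\ w \in L, nonneg w & j \in sigma L -> 0 < w 0 j].
  have [|js] := boolP (j \in sigma L); last first.
    by exists 0; split=> //; [exact: lat0 | move=> i; rewrite mxE].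
  rewrite inE => /asboolP[w [wL w0]]; rewrite inE => wj; exists w; split=> // _.
  by rewrite lt_def wj w0.
have [w h] := choice hw; pose s := \sum_j w j.
have s0 : nonneg s by move=> j; rewrite summxE sumr_ge0 // => i _; have [] := h i.
have sL : s \in L by apply: lat_sum => // j _; have [] := h j.
exists s; split=> // j js.
  rewrite summxE (bigD1 j) //= ltr_pwDl //; first by have [_ _ /(_ js)] := h j.
  by rewrite sumr_ge0 // => i _; have [_ ->] := h i.
apply: contrapT => /eqP sj; case/negP: js; rewrite inE; apply/asboolP.
by exists s; split=> //; rewrite inE.
Qed.

(** A large multiple of [sigma_vector] corrects the signs inside [sigma], after
    which the definition of [sigma] applies. *)
Lemma nonneg_off_sigma u : u \in L -> (forall j, j \notin sigma L -> 0 <= u 0 j) ->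
  forall j, j \notin sigma L -> u 0 j = 0.
Proof.
move=> uL u0 j js; have [w [wL w0 ws woff]] := sigma_vector.
pose N : int := \sum_i `|u 0 i|.
have leN i : `|u 0 i| <= N by rewrite /N (bigD1 i) //= ler_wpDr // sumr_ge0.
apply: contrapT => /eqP uj; case/negP: (js); rewrite inE; apply/asboolP.
exists (u + N *: w); split; first by rewrite latD ?latZ.
  move=> i; rewrite !mxE; have [si|si] := boolP (i \in sigma L); last first.
    by rewrite (woff _ si) mulr0 addr0 u0.
  by have := leN i; have := ws i si; move: (u 0 i) (w 0 i) (N) => x y M; nia.
by rewrite inE !mxE (woff _ js) mulr0 addr0.
Qed.

Lemma mem_sigma_lattice x :
  x \in sigma_lattice L <-> exists2 u, u \in L & x = drop_coords (sigma L) u.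
Proof.
split=> [/asboolP[m [c [q [hq ->]]]]|[u uL ->]]; last first.
  apply/asboolP; exists 1%N, (fun=> 1), (fun=> drop_coords (sigma L) u).
  by split=> [_|]; [exists u | rewrite big_ord1 scale1r].
have lift i : exists u, u \in L /\ q i = drop_coords (sigma L) u.
  by have [u] := hq i; exists u.
have [u hu] := choice lift.
exists (\sum_i c i *: u i).
  by apply: lat_sum => // i _; apply: latZ => //; have [] := hu i.
apply/rowP => j; rewrite mxE !summxE; apply: eq_bigr => i _.
by have [_ ->] := hu i; rewrite !mxE.
Qed.

End Sigma.

Section DropCoordinates.
Variables (n : nat) (L : {pred 'rV[int]_n}) (hL : zmod_closed L).
Implicit Types (u w : 'rV[int]_n) (s : {set 'I_n}).

Lemma drop_coordsD s u w : drop_coords s (u + w) = drop_coords s u + drop_coords s w.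
Proof. by apply/rowP => j; rewrite !mxE. Qed.

Lemma drop_coordsB s u w : drop_coords s (u - w) = drop_coords s u - drop_coords s w.
Proof. by apply/rowP => j; rewrite !mxE. Qed.

Definition inside_sigma : {pred 'rV[int]_n} :=
  [pred u | (u \in L) && [forall j, (j \notin sigma L) ==> (u 0 j == 0)]].

Lemma inside_sigmaP u :
  reflect (u \in L /\ forall j, j \notin sigma L -> u 0 j = 0) (u \in inside_sigma).
Proof.
apply: (iffP andP) => -[uL h]; split=> //.
  by move=> j js; have /forallP/(_ j) := h; rewrite js => /eqP.
by apply/forallP => j; apply/implyP => /h ->.
Qed.

Lemma inside_sigma_closed : zmod_closed inside_sigma.
Proof.
split; first by apply/inside_sigmaP; split=> [|j _]; [exact: lat0 | rewrite mxE].
move=> u v /inside_sigmaP[uL u0] /inside_sigmaP[vL v0]; apply/inside_sigmaP.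
by split=> [|j js]; [exact: latB | rewrite !mxE u0 // v0 // subrr].
Qed.

Lemma drop_inside_sigma u : u \in inside_sigma -> drop_coords (sigma L) u = 0.
Proof.
move=> /inside_sigmaP[_ u0]; apply/rowP => j; rewrite !mxE u0 //.
by have := enum_valP j; rewrite inE.
Qed.

Lemma inside_sigma_drop u : u \in L -> drop_coords (sigma L) u = 0 -> u \in inside_sigma.
Proof.
move=> uL u0; apply/inside_sigmaP; split=> // j js.
have js' : j \in ~: sigma L by rewrite inE.
by have /rowP/(_ (enum_rank_in js' j)) := u0; rewrite !mxE enum_rankK_in.
Qed.

End DropCoordinates.

(** * A mixed dominating basis connects *)

Lemma subset_of_card (T : finType) (X : {set T}) k : (k <= #|X|)%N ->
  exists2 Y : {set T}, Y \subset X & #|Y| = k.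
Proof.
move=> kX; have uX : uniq (take k (enum X)) by rewrite take_uniq ?enum_uniq.
exists [set x in take k (enum X)].
  by apply/subsetP => x; rewrite inE => /mem_take; rewrite mem_enum.
by rewrite cardsE; move/card_uniqP: uX ->; rewrite size_takel // -cardE.
Qed.

(** The cycles of [f], obtained all at once as a smallest nonempty stable set. *)
Lemma stable_subset (T : finType) (f : T -> T) (A : {set T}) :
  A != set0 -> {in A, forall x, f x \in A} ->
  exists X : {set T}, [/\ X != set0, X \subset A & f @: X = X].
Proof.
move=> A0 fA; pose P (X : {set T}) := [&& X != set0, X \subset A & f @: X \subset X].
have PA : P A.
  rewrite /P A0 subxx; apply/subsetP => _ /imsetP[x xA ->]; exact: fA.
case: (arg_minnP (fun X : {set T} => #|X|) PA) => X /and3P[X0 XA fX] min.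
exists X; split=> //; apply/eqP; rewrite eqEcard fX min //; apply/and3P; split.
- case/set0Pn: X0 => x xX; apply/set0Pn; exists (f x); exact: imset_f.
- exact: subset_trans fX XA.
- exact: imsetS.
Qed.

(** Suppose that each row [i] with [c 0 i != 0] is blocked at a column [(g i).1].
    There [u] is smaller than the decrease caused by row [i] alone, while the total
    change [u - v] is at most [u]; so the contribution of another row [(g i).2] has
    the opposite sign.  On a set of rows permuted by [(g _).2], each row then has
    both signs within the blocking columns, which are at most as many as
    the rows. *)
Lemma legal_move m p (M : 'M[int]_(m, p)) (u v : 'rV[int]_p) (c : 'rV[int]_m) :
  mixed_dominating M -> nonneg u -> nonneg v -> u - v = c *m M -> c != 0 ->
  exists i, c 0 i != 0 /\ forall j, 0 <= u 0 j - sgz (c 0 i) * M i j.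
Proof.
move=> [_ dom] u0 v0 uv c0; apply: contrapT => blocked.
have step i : c 0 i != 0 -> exists j k, 0 < c 0 i * M i j /\ c 0 k * M k j < 0.
  move=> ci; have [j uj] : exists j, u 0 j < sgz (c 0 i) * M i j.
    apply: contrapT => no; apply: blocked; exists i; split=> // j.
    by rewrite subr_ge0 leNgt; apply/negP => uj; apply: no; exists j.
  have cMj : 0 < c 0 i * M i j.
    have := u0 j; move: uj ci; case: sgzP => // ci; rewrite ?mul1r ?mulN1r; nia.
  exists j; apply: contrapT => no.
  have /rowP/(_ j) := uv; rewrite !mxE (bigD1 i) //= => e.
  have : 0 <= \sum_(k | k != i) c 0 k * M k j.
    by apply: sumr_ge0 => k _; rewrite leNgt; apply/negP => ck; apply: no; exists k.
  move: e (v0 j) uj cMj ci; move: (\sum_(k | _) _) => s; case: sgzP => // ci; nia.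
have [i0 ci0] := rV0Pn _ c0; have [j0 [k0 _]] := step i0 ci0.
have total i : exists x : 'I_p * 'I_m, c 0 i != 0 ->
    0 < c 0 i * M i x.1 /\ c 0 x.2 * M x.2 x.1 < 0.
  have [ci|/step[j [k h]]] := eqVneq (c 0 i) 0; last by exists (j, k).
  by exists (j0, k0).
have [g hg] := choice total.
have [||X [X0 XA fX]] := @stable_subset _ (fun i => (g i).2) [set i | c 0 i != 0].
- by apply/set0Pn; exists i0; rewrite inE.
- move=> i; rewrite !inE => /hg[_]; by case: eqP => // ->; rewrite mul0r.
pose J := [set (g i).1 | i in X].
have [I IX cI] := subset_of_card (leq_imset_card (fun i => (g i).1) X : (#|J| <= _)%N).
apply: (dom I J cI).
  by case/set0Pn: X0 => x xX; rewrite cI card_gt0; apply/set0Pn; exists (g x).1; apply: imset_f.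
move=> a; set i := enum_val a.
have iX : i \in X by apply/(subsetP IX)/enum_valP.
have nz k : k \in X -> c 0 k != 0 by move/(subsetP XA); rewrite inE.
have at_col j : j \in J -> exists b : 'I_#|J|, enum_val b = j.
  by move=> jJ; exists (enum_rank_in jJ j); rewrite enum_rankK_in.
have [k kX ik] : exists2 k, k \in X & i = (g k).2 by apply/imsetP; rewrite fX.
have [b1 hb1] := at_col _ (imset_f (fun i => (g i).1) iX).
have [b2 hb2] := at_col _ (imset_f (fun i => (g i).1) kX).
have [pos1 _] := hg _ (nz _ iX); have [_ neg2] := hg _ (nz _ kX).
rewrite -ik in neg2.
have M1 : mxsub (fun i : 'I_#|I| => enum_val i) (fun j : 'I_#|J| => enum_val j) M a b1 =
          M i (g i).1 by rewrite mxE hb1.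
have M2 : mxsub (fun i : 'I_#|I| => enum_val i) (fun j : 'I_#|J| => enum_val j) M a b2 =
          M i (g k).1 by rewrite mxE hb2.
have [ci|ci|ci] := ltgtP (c 0 i) 0; last by rewrite ci mul0r ltxx in pos1.
- by split; [exists b2; rewrite M2 | exists b1; rewrite M1]; nia.
- by split; [exists b1; rewrite M1 | exists b2; rewrite M2]; nia.
Qed.

Section RowMoves.
Variables (n r : nat) (D : 'M[int]_(r, n)).
Implicit Types (u w : 'rV[int]_n).

Definition row_moves := monomial_moves (fun i => mpos (row i D)) (fun i => mpos (- row i D)).

Lemma conn_sub_row i u : nonneg u -> nonneg (u - row i D) ->
  conn row_moves u (u - row i D).
Proof.
move=> u0 uD; set d := row i D in uD *.
have dE : mvec (mpos d) - mvec (mpos (- d)) = d by rewrite -mnm_diffE mnm_diff_mpos.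
have -> : u - d = (u - mvec (mpos d)) + mvec (mpos (- d)).
  by rewrite -{1}dE opprB addrA addrAC.
rewrite -{1}(subrK (mvec (mpos d)) u); apply: conn_move; first by exists i.
move=> j; have := uD j; have := u0 j; rewrite [(u - d) 0 j]mxE [(- d) 0 j]mxE.
rewrite [(u - mvec _) 0 j]mxE [(- mvec _) 0 j]mxE [mvec _ 0 j]mxE mnmE.
by move: (d 0 j) (u 0 j) => x y; lia.
Qed.

Lemma conn_add_rows u (e : 'rV[int]_r) : nonneg u -> nonneg e ->
  (forall i, e 0 i != 0 -> nonneg (row i D)) -> conn row_moves u (u + e *m D).
Proof.
move=> u0 e0 D0; rewrite mulmx_sum_row.
pose ok x := nonneg x /\ forall v, nonneg v -> conn row_moves v (v + x).
suff [_ h] : ok (\sum_i e 0 i *: row i D) by apply: h.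
have ok0 : ok 0.
  by split=> [j|v _]; [rewrite mxE | rewrite addr0; apply: conn_refl].
have okD x y : ok x -> ok y -> ok (x + y).
  move=> [x0 hx] [y0 hy]; split; first exact: nonnegD.
  by move=> v v0; rewrite addrA; apply: conn_trans (hx _ v0) (hy _ _); apply: nonnegD.
elim/big_ind: _ => // i _.
have [->|ei] := eqVneq (e 0 i) 0; first by rewrite scale0r.
have ok1 : ok (row i D).
  split=> [|v v0]; first exact: D0.
  apply: conn_sym; rewrite -{2}(addrK (row i D) v); apply: conn_sub_row; rewrite ?addrK //.
  by apply: nonnegD => //; apply: D0.
move: (e0 i); case: (e 0 i) => // k _.
rewrite -[Posz k]natz scaler_nat; elim: k => [|k ih]; first by rewrite mulr0n.
by rewrite mulrS; apply: okD.
Qed.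

End RowMoves.

(** The binomials of a basis of the following shape suffice: nonnegative vectors
    generating the part of [L] inside [sigma], and lifts of the rows of [M].  Adding
    the former makes the coordinates in [sigma] as large as needed, so that only
    the other coordinates can block a move; there [legal_move] provides a move
    that decreases the distance, measured by the coefficients of the lifts. *)
Lemma mixed_dominating_generates n (L : {pred 'rV[int]_n}) m
    (M : 'M[int]_(m, #|~: sigma L|)) :
  zmod_closed L -> lattice_basis M (sigma_lattice L) -> mixed_dominating M ->
  exists r (D : 'M[int]_(r, n)), lattice_basis D L /\ generates (row_moves D) L.
Proof.
move=> hL hM domM; have [hMs iM] := hM.
have [w [wL w0 ws woff]] := sigma_vector hL.
have [hLs LsP] := (inside_sigma_closed hL, inside_sigmaP L).
have wLs : w \in inside_sigma L by apply/LsP.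
have [|q [W [hbW W0]]] := nonneg_basis hLs wLs w0.
  by move=> u j /LsP[_ u0] wj; apply: u0; apply/negP => /ws; rewrite wj ltxx.
have [hW iW] := hbW.
have WLs i : row i W \in inside_sigma L by apply: lattice_basis_row hbW.
have lift i : exists u, u \in L /\ drop_coords (sigma L) u = row i M.
  by have /(mem_sigma_lattice hL)[u uL ->] := lattice_basis_row i hM; exists u.
have [u_ hu_] := choice lift.
have [U hU] : exists U : 'M[int]_(m, n), forall i, row i U = u_ i.
  by exists (\matrix_i u_ i) => i; rewrite rowK.
have hu i : row i U \in L /\ drop_coords (sigma L) (row i U) = row i M by rewrite hU.
have UL (c : 'rV[int]_m) : c *m U \in L.
  by apply: lat_mulmx => // i; have [] := hu i.
have dropU (c : 'rV[int]_m) : drop_coords (sigma L) (c *m U) = c *m M.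
  rewrite /drop_coords -mulmx_colsub; congr (_ *m _); apply/row_matrixP => i.
  by have [_ <-] := hu i; apply/rowP => j; rewrite !mxE.
have UM i k : U i (enum_val k) = M i k.
  by have [_ /rowP/(_ k)] := hu i; rewrite !mxE.
have WL (d : 'rV[int]_q) : d *m W \in inside_sigma L by apply: lat_mulmx.
have dropW (d : 'rV[int]_q) : drop_coords (sigma L) (d *m W) = 0.
  by apply: drop_inside_sigma.
have decomp u : u \in L -> exists (d : 'rV[int]_q) (c : 'rV[int]_m), u = d *m W + c *m U.
  move=> uL; have /hMs[c uc] : drop_coords (sigma L) u \in sigma_lattice L.
    by apply/(mem_sigma_lattice hL); exists u.
  have /hW[d hd] : u - c *m U \in inside_sigma L.
    apply: inside_sigma_drop; first by rewrite latB.
    by rewrite drop_coordsB dropU uc subrr.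
  by exists d, c; rewrite -hd subrK.
exists (q + m)%N, (col_mx W U); set D := col_mx W U.
have rowW k : row (lshift m k) D = row k W by rewrite rowKu.
have rowU k : row (rshift q k) D = row k U by rewrite rowKd.
split.
  split=> [u|c].
    split=> [/decomp[d [c ->]]|[c ->]]; first by exists (row_mx d c); rewrite mul_row_col.
    rewrite -[c]hsubmxK mul_row_col latD //.
    by have /LsP[] := WL (lsubmx c).
  rewrite -[c]hsubmxK mul_row_col => h.
  have r0 : rsubmx c = 0.
    apply: iM; rewrite -dropU; move/(congr1 (drop_coords (sigma L))): h.
    rewrite drop_coordsD dropW add0r => ->.
    by apply/rowP => j; rewrite !mxE.
  by move: h; rewrite r0 mul0mx addr0 => /iW ->; exact: row_mx0.
have connW x y (d : 'rV[int]_q) :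
    nonneg x -> nonneg y -> x - y = d *m W -> conn (row_moves D) x y.
  move=> x0 y0 xy.
  pose dp : 'rV[int]_q := \row_i Num.max (d 0 i) 0.
  pose dn : 'rV[int]_q := \row_i Num.max (- d 0 i) 0.
  have dE : d = dp - dn by apply/rowP => i; rewrite !mxE; move: (d 0 i) => a; lia.
  have up z (e : 'rV[int]_q) : nonneg z -> nonneg e -> conn (row_moves D) z (z + e *m W).
    move=> z0 e0; have -> : e *m W = row_mx e 0 *m D by rewrite mul_row_col mul0mx addr0.
    apply: conn_add_rows => // [i|i].
      by rewrite mxE; case: split => k; rewrite ?e0 // mxE.
    case: (split_ordP i) => k ->; first by rewrite rowW => _ j; rewrite mxE.
    by rewrite row_mxEr mxE eqxx.
  apply: (@conn_trans _ _ (x + dn *m W)).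
    by apply: up => // i; rewrite mxE; lia.
  have -> : x + dn *m W = y + dp *m W.
    by rewrite -(subrK y x) xy {1}dE mulmxBl addrAC subrK addrC.
  by apply: conn_sym; apply: up => // i; rewrite mxE; lia.
move=> u v u0 v0 /decomp[d [c uv]].
have [N] := ubnP (\sum_i absz (c 0%R i)).
elim: N u d c u0 uv => // N ih u d c u0 uv; rewrite ltnS => leN.
have [c0|c0] := eqVneq c 0; first by apply: (connW _ _ d) => //; rewrite uv c0 mul0mx addr0.
have duv : drop_coords (sigma L) u - drop_coords (sigma L) v = c *m M.
  by rewrite -drop_coordsB uv drop_coordsD dropW dropU add0r.
have drop_nonneg x : nonneg x -> nonneg (drop_coords (sigma L) x).
  by move=> x0 j; rewrite mxE.
have [i [ci legal]] := legal_move domM (drop_nonneg u u0) (drop_nonneg v v0) duv c0.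
(* Adding [R *: w] first makes room inside [sigma] for the legal move. *)
pose s := sgz (c 0 i); pose R : int := \sum_j `|U i j|.
have leR j : `|U i j| <= R by rewrite /R (bigD1 j) //= ler_wpDr // sumr_ge0.
have R0 : 0 <= R by apply: sumr_ge0.
have /hW[e eW] : R *: w \in inside_sigma L by apply: latZ.
pose u1 := u + R *: w; pose u2 := u1 - s *: row i U.
have u10 : nonneg u1 by apply: nonnegD => // j; rewrite mxE mulr_ge0.
have u20 : nonneg u2.
  move=> j; rewrite !mxE; have [js|js] := boolP (j \in sigma L).
    have := leR j; have := ws j js; have := u0 j; rewrite /s.
    by case: sgzP ci => // _ _; move: (u 0 j) (w 0 j) (U i j) (R) => x y z t; nia.
  have js' : j \in ~: sigma L by rewrite inE.
  have := legal (enum_rank_in js' j); rewrite -UM mxE enum_rankK_in //.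
  by rewrite woff // mulr0 addr0.
apply: (@conn_trans _ _ u1).
  by apply: (connW _ _ (- e)) => //; rewrite /u1 eW mulNmx opprD addrA subrr add0r.
apply: (@conn_trans _ _ u2).
  rewrite /u2; move: u20; rewrite /u2 /s; case: sgzP ci => // _ _.
    by rewrite scale1r -rowU => u20; apply: conn_sub_row.
  rewrite scaleN1r opprK => u20; apply: conn_sym.
  by rewrite -{2}(addrK (row i U) u1) -rowU; apply: conn_sub_row; rewrite ?rowU ?addrK.
apply: (ih u2 (d + e) (c - s *: delta_mx 0 i)) => //.
  rewrite mulmxBl -scalemxAl -rowE mulmxDl -eW /u2 /u1.
  rewrite [in RHS]addrACA -uv.
  by rewrite [u - v + _]addrAC -!addrA; congr (_ + (_ + _)); rewrite addrC.
apply: leq_trans leN; rewrite (bigD1 i) //= [X in (_ < X)%N](bigD1 i) //=.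
rewrite (eq_bigr (fun j => absz (c 0 j))); last first.
  by move=> j ji; rewrite !mxE eqxx (negPf ji) mulr0 subr0.
rewrite ltn_add2r !mxE !eqxx mulr1 /s.
by move: (c 0 i) ci => x; case: sgzP => // *; lia.
Qed.

(** * Generating moves give a mixed dominating basis *)

Section Necessity.
Variables (n : nat) (L : {pred 'rV[int]_n}) (hL : zmod_closed L).
Variables (r : nat) (B : 'M[int]_(r, n)) (hB : lattice_basis B L).
Variables (a b : 'I_r -> 'X_{1..n}).
Hypotheses (abL : forall i, mnm_diff (a i) (b i) \in L)
           (gen : generates (monomial_moves a b) L).
Implicit Types (Z : {set 'I_n}) (u w x y : 'rV[int]_n).

Let D : 'M[int]_(r, n) := \matrix_i mnm_diff (a i) (b i).

Definition zero_on Z x := forall j, j \in Z -> x 0 j = 0.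

Lemma zero_onD Z x y : nonneg x -> nonneg y ->
  zero_on Z (x + y) <-> zero_on Z x /\ zero_on Z y.
Proof.
move=> x0 y0; split=> [h|[hx hy] j jZ]; last by rewrite mxE hx // hy.
split=> j jZ; have := h j jZ; rewrite mxE; have := x0 j; have := y0 j;
  by move: (x 0 j) (y 0 j) => s t; lia.
Qed.

Let DE i j : D i j = (a i j)%:Z - (b i j)%:Z.
Proof. by rewrite !mxE. Qed.

Let rowD i : row i D = mvec (a i) - mvec (b i).
Proof. by rewrite rowK mnm_diffE. Qed.

(** On the face where the coordinates in [Z] vanish, only the moves between
    points of that face apply, provided that no move leaves the face; and a
    lattice vector that is nonnegative on [Z] joins a point of the face to
    another nonnegative point. *)
Lemma face_moves Z u :
  (forall i, zero_on Z (mvec (a i)) <-> zero_on Z (mvec (b i))) ->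
  u \in L -> (forall j, j \in Z -> 0 <= u 0 j) ->
  exists c : 'rV[int]_r, u = c *m D /\ forall i, c 0 i != 0 -> zero_on Z (mvec (a i)).
Proof.
move=> hZ uL u0.
pose x : 'rV[int]_n := \row_j if j \in Z then 0 else `|u 0 j|.
have x0 : nonneg x by move=> j; rewrite mxE; case: ifP.
have xu0 : nonneg (x + u).
  by move=> j; rewrite !mxE; case: ifP => [/u0|_]; move: (u 0 j) => y; lia.
have xZ : zero_on Z x by move=> j jZ; rewrite mxE jZ.
have /(gen x0 xu0) : x - (x + u) \in L by rewrite opprD addrA subrr add0r latN.
pose ok (y : 'rV[int]_n) := exists c : 'rV[int]_r,
  y = c *m D /\ forall i, c 0 i != 0 -> zero_on Z (mvec (a i)).
suff main y z : conn (monomial_moves a b) y z ->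
    (zero_on Z y <-> zero_on Z z) /\ (zero_on Z y -> ok (y - z)).
  move=> /main[_ /(_ xZ)[c [e hc]]]; exists (- c); split=> [|i].
    by rewrite mulNmx -e opprB addrAC subrr add0r.
  by rewrite mxE oppr_eq0 => /hc.
elim=> {y z} [y|y z _ [yz h]|y z w _ [yz h1] _ [zw h2]|w _ _ [i [-> ->]] w0].
- split=> // _; rewrite subrr; exists 0; split; first by rewrite mul0mx.
  by move=> i; rewrite mxE eqxx.
- split; first by split=> /yz.
  move=> /yz/h[c [e hc]]; exists (- c); rewrite mulNmx -e opprB; split=> // i.
  by rewrite mxE oppr_eq0 => /hc.
- split; first by split=> [/yz/zw|/zw/yz].
  move=> y0; have [c [e1 hc]] := h1 y0; have [d [e2 hd]] := h2 (yz.1 y0).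
  exists (c + d); rewrite mulmxDl -e1 -e2 addrA subrK; split=> // i.
  rewrite mxE; have [->|/hc //] := eqVneq (c 0 i) 0.
  by rewrite add0r => /hd.
have [ha hb] := (@mvec_nonneg _ (a i), @mvec_nonneg _ (b i)).
split; first by split=> /zero_onD[] // wZ /hZ ?; apply/zero_onD.
move=> /zero_onD[] // wZ aZ; exists (delta_mx 0 i); split.
  by rewrite -rowE rowD opprD addrACA subrr add0r.
by move=> l; rewrite mxE eqxx; have [->|] := eqVneq l i.
Qed.

Let basisD : lattice_basis D L.
Proof.
apply: (lattice_basis_of_generators hB) => u; apply/idP/rowspanP => [uL|[c ->]].
  have [|||c [-> _]] := @face_moves set0 u; last by exists c.
  - by move=> i; split=> _ j; rewrite inE.
  - by [].
  - by move=> j; rewrite inE.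
by apply: lat_mulmx => // i; rewrite rowK.
Qed.

(** By [nonneg_off_sigma], applied to the row and to its opposite. *)
Let row_mixed i j0 : j0 \notin sigma L -> D i j0 != 0 ->
  (exists2 j, j \notin sigma L & 0 < D i j) /\ (exists2 j, j \notin sigma L & D i j < 0).
Proof.
move=> js0 Dj0.
have rL : row i D \in L by apply: lattice_basis_row basisD.
split; apply: contrapT => no; case/eqP: Dj0.
- have h : forall j, j \notin sigma L -> 0 <= (- row i D) 0 j.
    move=> j js; rewrite !mxE oppr_ge0 leNgt; apply/negP => Dj; apply: no.
    by exists j; rewrite ?mxE.
  have := nonneg_off_sigma hL (latN hL rL) h js0.
  by rewrite mxE [row i D 0 j0]mxE => /eqP; rewrite oppr_eq0 => /eqP.
- have h : forall j, j \notin sigma L -> 0 <= (row i D) 0 j.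
    by move=> j js; rewrite [row i D 0 j]mxE leNgt; apply/negP => Dj; apply: no; exists j.
  by have := nonneg_off_sigma hL rL h js0; rewrite [row i D 0 j0]mxE.
Qed.

Let mixed_on Z i := [exists j in Z, 0 < D i j] && [exists j in Z, D i j < 0].

Let face_of_closed Z :
  (forall i j, j \in Z -> D i j != 0 -> mixed_on Z i) ->
  forall i, zero_on Z (mvec (a i)) <-> zero_on Z (mvec (b i)).
Proof.
move=> closed i; split=> h j jZ; apply: contrapT => /eqP; have := h j jZ;
  rewrite !mxE => zj nzj.
- have Dj : D i j != 0 by rewrite DE; lia.
  have /andP[/existsP[l /andP[lZ Dl]] _] := closed i j jZ Dj.
  by have := h l lZ; move: Dl; rewrite DE mxE; lia.
- have Dj : D i j != 0 by rewrite DE; lia.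
  have /andP[_ /existsP[l /andP[lZ Dl]]] := closed i j jZ Dj.
  by have := h l lZ; move: Dl; rewrite DE mxE; lia.
Qed.

(** As there are at least as many mixed rows as columns in [Z], a nontrivial
    combination of mixed rows is zero on [Z], or else one is a positive constant
    there.  By [face_moves] it is also a combination of rows that vanish on [Z],
    which contradicts the independence of the rows. *)
Let no_closed_face Z : Z != set0 ->
  (forall i j, j \in Z -> D i j != 0 -> mixed_on Z i) ->
  (#|Z| <= #|[set i | mixed_on Z i]|)%N -> False.
Proof.
move=> /set0Pn[z0 z0Z] closed; set I := [set i | _] => cardZ.
have [_ iD] := basisD.
pose P : 'M[int]_(#|I|, r) := rowsub (fun k : 'I_#|I| => enum_val k) 1%:M.
pose A := P *m D *m (colsub (fun k : 'I_#|Z| => enum_val k) 1%:M).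
(* The additional row turns a relation into a combination that is constant
   on [Z]. *)
have [|c c0 cA] := int_row_dependent (col_mx A (const_mx (-1) : 'rV_#|Z|)).
  by rewrite addn1 ltnS.
have {c c0 cA}[c [t [ct0 t0 ctA]]] : exists (c : 'rV[int]_#|I|) (t : int),
    [/\ (c != 0) || (t != 0), 0 <= t & c *m A = const_mx t].
  have h : lsubmx c *m A = const_mx (rsubmx c 0 0).
    move: cA; rewrite -{1}[c]hsubmxK mul_row_col => /eqP; rewrite addr_eq0 => /eqP ->.
    apply/rowP => j; rewrite [rsubmx c]mx11_scalar mul_scalar_mx !mxE eqxx mulr1n.
    by rewrite mulrN1 opprK.
  have nz : (lsubmx c != 0) || (rsubmx c 0 0 != 0).
    rewrite -negb_and; apply: contra c0 => /andP[/eqP l0 /eqP r0].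
    by rewrite -[c]hsubmxK l0 [rsubmx c]mx11_scalar r0 raddf0 row_mx0.
  have [t0|t0] := leP 0 (rsubmx c 0 0); first by exists (lsubmx c), (rsubmx c 0 0).
  exists (- lsubmx c), (- rsubmx c 0 0); rewrite !oppr_eq0 oppr_ge0 ltW //; split=> //.
  by rewrite mulNmx h; apply/rowP => j; rewrite !mxE.
pose u := c *m P *m D.
have uZ j : j \in Z -> u 0 j = t.
  move=> jZ; move/rowP: ctA => /(_ (enum_rank_in jZ j)); rewrite [RHS]mxE => <-.
  by rewrite /A !mulmxA mulmx_colsub mulmx1 [RHS]mxE enum_rankK_in.
have [||c' [uc' hc']] := face_moves (face_of_closed closed) _ _ (u := u).
- by apply: lat_mulmx => // i; apply: lattice_basis_row basisD.
- by move=> j /uZ ->.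
have c'I i : i \in I -> c' 0 i = 0.
  rewrite inE => /andP[/existsP[j /andP[jZ Dj]] _]; apply: contrapT => /eqP /hc' ha.
  have hb := (face_of_closed closed i).1 ha.
  by have := ha j jZ; have := hb j jZ; move: Dj; rewrite DE !mxE; lia.
have cP : c *m P = c'.
  by apply/eqP; rewrite -subr_eq0; apply/eqP/iD; rewrite mulmxBl -uc' subrr.
have c0 : c = 0.
  apply/rowP => k; rewrite mxE -(c'I (enum_val k) (enum_valP k)) -cP.
  rewrite mxE (bigD1 k) //= !mxE eqxx mulr1 big1 ?addr0 // => l lk.
  by rewrite !mxE (inj_eq enum_val_inj) (negPf lk) mulr0.
move: ct0; rewrite c0 eqxx /= => /eqP; apply.
by rewrite -(uZ z0 z0Z) /u c0 !mul0mx mxE.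
Qed.

(** A square mixed submatrix starts a growing family of column sets: a row
    with only one sign on [Z] has the other sign in some column outside of [Z], and
    adding that column makes one more row mixed. *)
Let no_mixed_set (Z0 : {set 'I_n}) : Z0 != set0 -> Z0 \subset ~: sigma L ->
  (#|Z0| <= #|[set i | mixed_on Z0 i]|)%N -> False.
Proof.
move=> Z00 Z0s cZ0.
pose ok Z := [&& Z != set0, Z \subset ~: sigma L & (#|Z| <= #|[set i | mixed_on Z i]|)%N].
have okZ0 : ok Z0 by rewrite /ok Z00 Z0s.
case: (@arg_maxnP _ Z0 ok (fun Z => #|Z|) okZ0) => Z /and3P[Zn0 Zs cZ] max.
apply: (no_closed_face Zn0 _ cZ) => i j jZ Dj; apply: contrapT => /negP nmix.
have off l : l \in Z -> l \notin sigma L by move/(subsetP Zs); rewrite inE.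
have [[p ps Dp] [q qs Dq]] := row_mixed (off j jZ) Dj.
have [l [ls lZ mixl]] : exists l, [/\ l \notin sigma L, l \notin Z & mixed_on (l |: Z) i].
  have [Dj0|Dj0] := ltP (D i j) 0.
    have pZ : p \notin Z.
      apply/negP => pZ; case/negP: nmix; apply/andP; split; apply/existsP.
        by exists p; rewrite pZ.
      by exists j; rewrite jZ.
    exists p; split=> //; apply/andP; split; apply/existsP.
      by exists p; rewrite setU11.
    by exists j; rewrite setU1r.
  have qZ : q \notin Z.
    apply/negP => qZ; case/negP: nmix; apply/andP; split; apply/existsP.
      by exists j; rewrite jZ lt_def Dj.
    by exists q; rewrite qZ.
  exists q; split=> //; apply/andP; split; apply/existsP.
    by exists j; rewrite setU1r //= lt_def Dj.
  by exists q; rewrite setU11.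
have : ok (l |: Z).
  apply/and3P; split.
  - by apply/set0Pn; exists l; rewrite setU11.
  - by rewrite subUset sub1set inE ls.
  rewrite cardsU1 lZ add1n; apply: leq_ltn_trans cZ _; apply: proper_card.
  apply/properP; split; last by exists i; rewrite inE.
  apply/subsetP => k; rewrite !inE => /andP[/existsP[x /andP[xZ Dx]] /existsP[y /andP[yZ Dy]]].
  by apply/andP; split; apply/existsP; [exists x | exists y]; rewrite setU1r.
by move=> /max; rewrite /= cardsU1 lZ add1n ltnn.
Qed.

(** The moves with both points inside [sigma] generate [inside_sigma L], by
    [face_moves] applied to the complement of [sigma]; so the rows of the other
    moves, [T], stay independent after projection. *)
Lemma generating_moves_basis : exists m (M : 'M[int]_(m, #|~: sigma L|)),
  lattice_basis M (sigma_lattice L) /\ mixed_dominating M.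
Proof.
have [_ iD] := basisD.
have Dface : forall i, zero_on (~: sigma L) (mvec (a i)) <-> zero_on (~: sigma L) (mvec (b i)).
  apply: face_of_closed => i j; rewrite inE => js Dj.
  have [[p ps Dp] [q qs Dq]] := row_mixed js Dj.
  by apply/andP; split; apply/existsP; [exists p | exists q]; rewrite inE ?ps ?qs.
pose T := [set i | ~~ [forall j in ~: sigma L, mvec (a i) 0 j == 0]].
have TP i : i \notin T -> zero_on (~: sigma L) (mvec (a i)).
  by rewrite inE negbK => /forallP h j js; have := h j; rewrite js => /eqP.
have rowT0 i : i \notin T -> drop_coords (sigma L) (row i D) = 0.
  move=> /TP ha; have hb := (Dface i).1 ha.
  apply/rowP => k; rewrite rowD !mxE.
  have := ha _ (enum_valP k); have := hb _ (enum_valP k); rewrite !mxE => -> ->.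
  by rewrite subrr.
pose P : 'M[int]_(#|T|, r) := rowsub (fun k : 'I_#|T| => enum_val k) 1%:M.
pose M : 'M[int]_(#|T|, #|~: sigma L|) := \matrix_(k, l) D (enum_val k) (enum_val l).
have dropP (c : 'rV[int]_#|T|) : drop_coords (sigma L) (c *m P *m D) = c *m M.
  rewrite /drop_coords -!mulmxA -mulmx_colsub; congr (_ *m _).
  by rewrite mul_rowsub_mx mul1mx; apply/matrixP => k l; rewrite !mxE.
have dropD (c : 'rV[int]_r) : drop_coords (sigma L) (c *m D) =
    (\row_k c 0 (enum_val k)) *m M.
  apply/rowP => l; rewrite !mxE (bigID (mem T)) /= [X in _ + X]big1 ?addr0.
    by rewrite big_enum_val /=; apply: eq_bigr => k _; rewrite !mxE.
  by move=> i /rowT0/rowP/(_ l); rewrite mxE [row i D _ _]mxE [RHS]mxE => ->; rewrite mulr0.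
have memL (c : 'rV[int]_r) : c *m D \in L by apply/basisD.1; exists c.
have basisM : lattice_basis M (sigma_lattice L).
  split=> [w|c cM].
    split=> [/(mem_sigma_lattice hL)[u uL ->]|[c ->]].
      by have [c ->] := (basisD.1 u).1 uL; rewrite dropD; eexists.
    by apply/(mem_sigma_lattice hL); exists (c *m P *m D); rewrite ?dropP.
  have cP0 : drop_coords (sigma L) (c *m P *m D) = 0 by rewrite dropP.
  have [||c' [uc' hc']] := face_moves Dface _ _ (u := c *m P *m D).
  - exact: memL.
  - have /(inside_sigma_drop (memL _))/inside_sigmaP[_ h] := cP0.
    by move=> j; rewrite inE => /h ->.
  have cP : c *m P = c'.
    by apply/eqP; rewrite -subr_eq0; apply/eqP/iD; rewrite mulmxBl -uc' subrr.
  apply/rowP => k; rewrite mxE.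
  have -> : c 0 k = c' 0 (enum_val k).
    rewrite -cP mxE (bigD1 k) //= !mxE eqxx mulr1 big1 ?addr0 // => l lk.
    by rewrite !mxE (inj_eq enum_val_inj) (negPf lk) mulr0.
  apply: contrapT => /eqP /hc' ha; have := enum_valP k; rewrite inE => /negP; apply.
  by apply/forallP => j; apply/implyP => /ha ->.
exists #|T|, M; split=> //; split.
  move=> k.
  have [l Mkl] : exists l, M k l != 0.
    apply: contrapT => no; have /rowP/(_ k) : delta_mx 0 k = 0 :> 'rV[int]_#|T|.
      apply: basisM.2; rewrite -rowE; apply/rowP => l; rewrite [LHS]mxE [RHS]mxE.
      by apply: contrapT => /eqP h; apply: no; exists l.
    by rewrite !mxE !eqxx.
  have ls := enum_valP l; rewrite inE in ls.
  have [|[p ps Dp] [q qs Dq]] := @row_mixed (enum_val k) (enum_val l) ls.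
    by move: Mkl; rewrite mxE.
  have ps' : p \in ~: sigma L by rewrite inE.
  have qs' : q \in ~: sigma L by rewrite inE.
  by split; [exists (enum_rank_in ps' p) | exists (enum_rank_in qs' q)];
    rewrite mxE enum_rankK_in.
move=> I J cIJ I0 mixIJ.
apply: (@no_mixed_set [set enum_val l | l in J]).
- have /card_gt0P[l lJ] : (0 < #|J|)%N by rewrite -cIJ.
  by apply/set0Pn; exists (enum_val l); apply: imset_f.
- by apply/subsetP => _ /imsetP[l _ ->]; apply: enum_valP.
rewrite card_imset; last exact: enum_val_inj.
rewrite -cIJ -(card_imset _ (@enum_val_inj _ (mem T))).
apply: subset_leq_card; apply/subsetP => _ /imsetP[k kI ->]; rewrite inE.
have [[x hx] [y hy]] := mixIJ (enum_rank_in kI k).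
rewrite 2!mxE enum_rankK_in // in hx; rewrite 2!mxE enum_rankK_in // in hy.
apply/andP; split; apply/existsP.
  exists (enum_val (enum_val x)); rewrite hx andbT; exact/imset_f/enum_valP.
exists (enum_val (enum_val y)); rewrite hy andbT; exact/imset_f/enum_valP.
Qed.

End Necessity.

(** * The characterization *)

Theorem corollary5p6 (K : fieldType) (n : nat) (L : {pred 'rV[int]_n})
    (hL : zmod_closed L) :
  binomial_complete_intersection (lattice_ideal K L) <->
  (sigma_lattice L =i pred1 0 \/
   exists (m : nat) (M : 'M[int]_(m, #|~: sigma L|)),
     lattice_basis M (sigma_lattice L) /\ mixed_dominating M).
Proof.
split=> [[r [hr [p [bin_p Ip]]]]|hM].
  have [r' [B hB]] := lattice_basis_exists hL.
  have er := ideal_height_uniq (lattice_ideal_height K hL hB) hr.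
  move: er B hB => -> B hB.
  have split_p i : exists x : 'X_{1..n} * 'X_{1..n}, p i = 'X_[x.1] - 'X_[x.2].
    by have [u [v [_ ->]]] := bin_p i; exists (u, v).
  have [x px] := choice split_p; right.
  pose a i := (x i).1; pose b i := (x i).2.
  have [|abL gen] := (lattice_ideal_generated K a b hL).1; last first.
    exact: (generating_moves_basis hL hB abL gen).
  have -> : (fun q => exists i, q = 'X_[a i] - 'X_[b i]) = (fun q => exists i, q = p i).
    by apply/funext => q; apply/propext; split=> -[i ->]; exists i; rewrite px.
  exact: Ip.
have [m [M [hbM domM]]] : exists (m : nat) (M : 'M[int]_(m, #|~: sigma L|)),
    lattice_basis M (sigma_lattice L) /\ mixed_dominating M.
  case: hM => // L0; exists 0%N, 0; split; last first.
    by split=> [[]|I J _] //; rewrite card_gt0 => /set0Pn[[]].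
  split=> [w|c _]; last by rewrite [c]thinmx0.
  rewrite L0 inE; split=> [/eqP ->|[c ->]]; last by rewrite mulmx0.
  by exists 0; rewrite mulmx0.
have [r [D [hD gen]]] := mixed_dominating_generates hL hbM domM.
exists r; split; first exact: lattice_ideal_height hD.
exists (fun i => 'X_[mpos (row i D)] - 'X_[mpos (- row i D)]); split=> [i|].
  exists (mpos (row i D)), (mpos (- row i D)); split=> //.
  apply/eqP => e; have := mnm_diff_mpos (row i D); rewrite e mnm_diffE subrr rowE.
  move=> /esym/(hD.2)/rowP/(_ i); rewrite !mxE !eqxx => /eqP.
  by rewrite oner_eq0.
apply/(lattice_ideal_generated K _ _ hL); split=> // i.
by rewrite mnm_diff_mpos; apply: lattice_basis_row hD.
Qed.
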